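(* Let $\{S_i\}_{i=1}^m$ be a self-similar iterated function system in $\mathbb{R}^2$ with attractor $K$ such that $\{S_i\}_{i=1}^m$ satisfies the strong separation condition and $K$ is a $1$-set. Then there are at most finitely many lines $M$ through the origin such that the orthogonal projection $\Pi_M$ onto $M$ is an interval projection of $K$.
   Context: A self-similar iterated function system (SS-IFS) in $\mathbb{R}^2$ is a finite collection $\{S_i\}_{i=1}^m$ of contracting similarities $S_i:\mathbb{R}^2\to\mathbb{R}^2$, i.e. $S_i(x)=r_iT_i(x)+v_i$ with $0<r_i<1$, $T_i$ an orthogonal transformation and $v_i\in\mathbb{R}^2$. Its attractor is the unique nonempty compact set $K$ with $K=\bigcup_{i=1}^m S_i(K)$. The SS-IFS satisfies the strong separation condition if the sets $S_1(K),\dots,S_m(K)$ are pairwise disjoint. $K$ is a $1$-set if $0<\mathcal{H}^1(K)<\infty$, where $\mathcal{H}^1$ is $1$-dimensional Hausdorff measure. For a line $M\subseteq\mathbb{R}^2$ through the origin, $\Pi_M:\mathbb{R}^2\to M$ is the orthogonal projection onto $M$; it is called an interval projection of $K$ if $\Pi_M(K)$ is an interval under the identification $M=\mathbb{R}$ (a single point counts as a closed interval of length $0$). *)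

(* Defs.v *)
From HB Require Import structures.
From mathcomp Require Import all_boot all_order all_algebra.
From mathcomp Require Import all_classical all_reals all_analysis.

Set Implicit Arguments.
Unset Strict Implicit.
Unset Printing Implicit Defensive.

Import Order.TTheory GRing.Theory Num.Theory.
Import numFieldNormedType.Exports.

Local Open Scope classical_set_scope.
Local Open Scope ring_scope.

(* Points of R^n are row vectors. The library norm on 'rV[R]_n is the sup norm:
   it induces the usual topology, which is what [compact] below refers to, but
   lengths, distances and diameters must be Euclidean, whence [edot]. *)

Section Euclidean.
Context {R : realType} {n : nat}.
Implicit Types (x y u : 'rV[R]_n) (A K : set 'rV[R]_n).

Definition edot x y : R := \sum_(i < n) x 0 i * y 0 i.

Definition enorm x : R := Num.sqrt (edot x x).

(* The bound 0 only matters for [A = set0], whose diameter is 0. *)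
Definition ediam A : \bar R :=
  ereal_sup ([set 0%E] `|` [set (enorm (p.1 - p.2))%:E | p in A `*` A]).

(* Countable covers by arbitrary sets; finite covers are included by padding
   with [set0]. *)
Definition hausdorff1_delta (delta : R) A : \bar R :=
  ereal_inf [set (\sum_(0 <= k <oo) ediam (U k))%E
            | U in [set U : nat -> set 'rV[R]_n |
                     A `<=` \bigcup_k U k /\
                     forall k, (ediam (U k) <= delta%:E)%E]].

Definition hausdorff1 A : \bar R :=
  ereal_sup [set hausdorff1_delta delta A | delta in [set d : R | 0 < d]].

Definition one_set K := (0 < hausdorff1 K < +oo)%E.

Definition contracting_similarity (f : 'rV[R]_n -> 'rV[R]_n) :=
  exists (r : R) (T : 'M[R]_n) (v : 'rV[R]_n),
    [/\ 0 < r < 1, T *m T^T = 1%:M & forall x, f x = r *: (x *m T) + v].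

Definition ss_ifs m (S : 'I_m -> 'rV[R]_n -> 'rV[R]_n) :=
  forall i, contracting_similarity (S i).

Definition attractor m (S : 'I_m -> 'rV[R]_n -> 'rV[R]_n) K :=
  [/\ K !=set0, compact K & K = \bigcup_i S i @` K].

Definition strong_separation m (S : 'I_m -> 'rV[R]_n -> 'rV[R]_n) K :=
  trivIset setT (fun i => S i @` K).

(* [xget] picks the unique point of [M] with [x - y] orthogonal to [M]. *)
Definition orth_proj (M : {vspace 'rV[R]_n}) x : 'rV[R]_n :=
  xget 0 [set y | y \in M /\ forall z, z \in M -> edot (x - y) z = 0].

(* For a line [M], a unit vector [u] of [M] gives the isometric identification
   [t |-> t *: u] of R with [M]. *)
Definition interval_projection K (M : {vspace 'rV[R]_n}) :=
  exists u, [/\ u \in M, enorm u = 1 &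
    is_interval [set t : R | (orth_proj M @` K) (t *: u)]].

End Euclidean.

(* Main.v *)
(* With [h = H^1(K)], separation gives [h >= (sum r_i) h], so [sum r_i <= 1].
   Write [L(u)] for the outer content of the projection [{u . x | x in K}]
   ([u] a unit vector), so that [L(u) <= sum r_i L(u T_i^T)]: at a direction
   where [L] is maximal the same maximal value is attained in all the directions
   [u T_i^T], and the pieces [S_i K] have essentially disjoint projections.

   If the rotation parts of the [S_w], [w] a word, form an infinite set, then
   they contain arbitrarily small rotations and the projections of the
   cylinders are almost disjoint in directions that fill the circle; a
   logarithmically divergent energy sum then forces [L = 0], so that no
   projection is a nondegenerate interval.

   If they form a finite set, then [L] is constant on the orbit of [u], and the
   convex hull of [K] is a polygon. Let [u . K] be a nondegenerate interval and
   let [w] be a fixed word whose rotation part is trivial. Then [u . S_w K] is a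
   smaller interval, say with right end [t] interior to [u . K]; no cylinder
   outside [S_w K] projects into its interior, so a cylinder [S_g K] of fixed
   length [n] must have its left end at [t]. Hence [u] is orthogonal to a nonzero
   difference of images of vertices, out of finitely many possibilities. *)
From HB Require Import structures.
Require Import Defs.
From mathcomp Require Import all_boot all_order all_algebra.
From mathcomp Require Import all_classical all_reals all_analysis.
From mathcomp Require Import ring lra zify.

Set Implicit Arguments.
Unset Strict Implicit.
Unset Printing Implicit Defensive.

Import Order.TTheory GRing.Theory Num.Theory.
Import numFieldNormedType.Exports.

Local Open Scope classical_set_scope.
Local Open Scope ring_scope.

(** * Outer content of bounded sets of reals *)

Section Content.
Context {R : realType}.
Implicit Types (A B : set R) (s : seq (R * R)).

Definition covers s A :=
  forall x, A x -> has (fun I : R * R => I.1 <= x < I.2) s.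

(** The absolute value keeps lengths nonnegative for reversed pairs, so every list is a legitimate
    competitor. *)
Definition cover_length s : R := \sum_(I <- s) `|I.2 - I.1|.

Definition coverable A := exists s, covers s A.

(** Jordan outer content: covers are finite. If no cover exists the infimum is that of the empty
    set, which is 0; this is why monotonicity asks for [coverable B]. *)
Definition content A : R := inf [set cover_length s | s in covers^~ A].

Lemma cover_length_ge0 s : 0 <= cover_length s.
Proof. by apply: sumr_ge0 => I _; exact: normr_ge0. Qed.

Lemma coverable_itv A a b : (forall x, A x -> a <= x < b) -> coverable A.
Proof. by move=> Aab; exists [:: (a, b)] => x /Aab xab /=; rewrite xab. Qed.

Lemma content_has_lbound A :
  has_lbound [set cover_length s | s in covers^~ A].
Proof. by exists 0 => _ [s _ <-]; exact: cover_length_ge0. Qed.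

Lemma content_ge0 A : 0 <= content A.
Proof.
rewrite /content.
have [->|/set0P A0] := eqVneq [set cover_length s | s in covers^~ A] set0.
  by rewrite inf0.
by apply: lb_le_inf => // _ [s _ <-]; exact: cover_length_ge0.
Qed.

Lemma content_le_cover s A : covers s A -> content A <= cover_length s.
Proof. by move=> sA; apply: ge_inf; [exact: content_has_lbound|exists s]. Qed.

Lemma content_adherent A e : coverable A -> 0 < e ->
  exists2 s, covers s A & cover_length s < content A + e.
Proof.
move=> [s0 s0A] e0.
have : has_inf [set cover_length s | s in covers^~ A].
  by split; [exists (cover_length s0), s0|exact: content_has_lbound].
by move=> /(inf_adherent e0)[_ [s sA <-] slt]; exists s.
Qed.

Lemma content_sub A B : coverable B -> A `<=` B -> content A <= content B.
Proof.
move=> cB AB; apply/ler_addgt0Pr => e e0.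
have [s sB /ltW slt] := content_adherent cB e0.
apply: le_trans slt; apply: content_le_cover => x /AB; exact: sB.
Qed.

Lemma content_setU A B : coverable A -> coverable B ->
  coverable (A `|` B) /\ content (A `|` B) <= content A + content B.
Proof.
have cat_covers s t : covers s A -> covers t B -> covers (s ++ t) (A `|` B).
  move=> sA tB x [/sA|/tB] h; rewrite has_cat h ?orbT //.
move=> cA cB; split.
  by case: cA cB => s sA [t tB]; exists (s ++ t); exact: cat_covers.
apply/ler_addgt0Pr => e e0; have e20 : 0 < e / 2 by lra.
have [s sA slt] := content_adherent cA e20.
have [t tB tlt] := content_adherent cB e20.
apply: le_trans (content_le_cover (cat_covers _ _ sA tB)) _.
by rewrite /cover_length big_cat /= -!/(cover_length _); lra.
Qed.

Lemma content_set0 : coverable set0 /\ content set0 = 0.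
Proof.
have c0 : covers [::] (@set0 R) by [].
split; first by exists [::].
apply/eqP; rewrite eq_le content_ge0 andbT (le_trans (content_le_cover c0))//.
by rewrite /cover_length big_nil.
Qed.

Lemma content_bigU (T : eqType) (w : seq T) (F : T -> set R) :
  (forall i, i \in w -> coverable (F i)) ->
  coverable [set x | exists2 i, i \in w & F i x] /\
  content [set x | exists2 i, i \in w & F i x] <= \sum_(i <- w) content (F i).
Proof.
elim: w => [|i w IH] cF.
  rewrite big_nil (_ : [set x | _] = set0); last first.
    by apply/seteqP; split => // x [].
  by have [? ->] := content_set0; split.
have -> : [set x | exists2 j, j \in i :: w & F j x] =
    F i `|` [set x | exists2 j, j \in w & F j x].
  apply/seteqP; split => x /=.
    by move=> [j]; rewrite inE => /orP[/eqP->|jw]; [left|right; exists j].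
  move=> [Fx|[j jw Fx]]; first by exists i; rewrite ?mem_head.
  by exists j => //; rewrite inE jw orbT.
have [|cw lw] := IH; first by move=> j jw; apply: cF; rewrite inE jw orbT.
have [|c l] := content_setU (cF i _) cw; first exact: mem_head.
by split => //; rewrite big_cons; lra.
Qed.

Lemma content_affine (r t : R) A : 0 < r -> coverable A ->
  coverable [set r * x + t | x in A] /\
  content [set r * x + t | x in A] <= r * content A.
Proof.
move=> r0 cA.
pose f s : seq (R * R) := map (fun J => (r * J.1 + t, r * J.2 + t)) s.
have fcov s : covers s A -> covers (f s) [set r * x + t | x in A].
  move=> sA _ [x /sA /hasP[I Is Ix] <-]; apply/hasP.
  exists (r * I.1 + t, r * I.2 + t); first by apply/mapP; exists I.
  by rewrite /= lerD2r ltrD2r ler_pM2l// ltr_pM2l.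
have flen s : cover_length (f s) = r * cover_length s.
  rewrite /cover_length big_map mulr_sumr; apply: eq_bigr => I _ /=.
  by rewrite -[in RHS](gtr0_norm r0) -normrM; congr `|_|; ring.
split; first by case: cA => s /fcov ?; exists (f s).
apply/ler_addgt0Pr => e e0.
have [|s sA slt] := @content_adherent A (e / r) cA; first by rewrite divr_gt0.
apply: le_trans (content_le_cover (fcov _ sA)) _; rewrite flen.
have /ltW := slt; rewrite -(ler_pM2l r0) mulrDr mulrCA divff ?gt_eqF// mulr1.
by [].
Qed.

(* Half-open intervals make the induction work: once the interval [I] that
   contains [a] is removed, the others still cover [[I.2, b)]. *)
Lemma cover_length_itv s a b :
  covers s [set x | a <= x < b] -> b - a <= cover_length s.
Proof.
elim: (size s) {-2}s (leqnn (size s)) a => {s} [|n IH] s sn a sab.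
  case: s sn sab => // _ sab; have [ab|] := ltP a b.
    by have := sab a; rewrite /= lexx ab => /(_ isT).
  by rewrite /cover_length big_nil; lra.
have [ab|] := ltP a b; last by have := cover_length_ge0 s; lra.
have /hasP[I Is /andP[Ia aI]] : has (fun I : R * R => I.1 <= a < I.2) s.
  by apply: sab; rewrite /= lexx ab.
have := perm_to_rem Is => sI.
have -> : cover_length s = `|I.2 - I.1| + cover_length (rem I s).
  by rewrite /cover_length (perm_big _ sI) big_cons.
have : b - I.2 <= cover_length (rem I s).
  apply: IH.
    by rewrite size_rem//; case: (size s) sn.
  move=> x /= /andP[Ix xb].
  have /hasP[J Js xJ] : has (fun I : R * R => I.1 <= x < I.2) s.
    by apply: sab; rewrite /= xb andbT; lra.
  apply/hasP; exists J => //.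
  have : J \in I :: rem I s by rewrite -(perm_mem sI).
  by rewrite inE => /orP[/eqP JI|//]; move: xJ; rewrite JI; lra.
have := ler_norm (I.2 - I.1); lra.
Qed.

Lemma content_interval A a b : coverable A -> is_interval A -> A a -> A b ->
  b - a <= content A.
Proof.
move=> cA iA Aa Ab; apply/ler_addgt0Pr => e e0.
have [s sA /ltW slt] := content_adherent cA e0.
apply: le_trans slt; apply: cover_length_itv => x /= /andP[ax xb].
by apply: sA; apply: iA Aa Ab _ _; rewrite ax ltW.
Qed.

Lemma content_itv_le A a b : a <= b -> (forall x, A x -> a <= x < b) ->
  content A <= b - a.
Proof.
move=> ab Aab.
have /content_le_cover : covers [:: (a, b)] A by move=> x /Aab /= ->.
by rewrite /cover_length big_seq1 /= ger0_norm// subr_ge0.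
Qed.

End Content.

(** * Plane geometry, words and rotations *)

Section Dot.
Context {R : realType}.
Implicit Types (u x y : 'rV[R]_2).

Lemma edotE u x : edot u x = u 0 0 * x 0 0 + u 0 1 * x 0 1.
Proof.
rewrite /edot !big_ord_recr big_ord0 /= add0r.
by congr (_ * _ + _ * _); congr (_ _ _); exact: val_inj.
Qed.

Lemma edotBr u x y : edot u (x - y) = edot u x - edot u y.
Proof. by rewrite !edotE !mxE; ring. Qed.

Lemma edotNl u x : edot (- u) x = - edot u x.
Proof. by rewrite !edotE !mxE; ring. Qed.

Lemma edotZr a u x : edot u (a *: x) = a * edot u x.
Proof. by rewrite !edotE !mxE; ring. Qed.

Lemma edotZl a u x : edot (a *: u) x = a * edot u x.
Proof. by rewrite !edotE !mxE; ring. Qed.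

Lemma edotC u x : edot u x = edot x u.
Proof. by rewrite !edotE; ring. Qed.

Lemma edot_mul u x : edot u x = (u *m x^T) 0 0.
Proof. by rewrite /edot mxE; apply: eq_bigr => i _; rewrite !mxE. Qed.

Lemma edot_mulmx u x (M : 'M[R]_2) : edot u (x *m M) = edot (u *m M^T) x.
Proof. by rewrite !edot_mul trmx_mul mulmxA. Qed.

Lemma edot_orth u (M : 'M[R]_2) :
  M *m M^T = 1%:M -> edot (u *m M^T) (u *m M^T) = edot u u.
Proof.
by move=> /mulmx1C MM; rewrite edot_mulmx trmxK -mulmxA MM mulmx1.
Qed.

Lemma edot_ge0 x : 0 <= edot x x.
Proof. by rewrite edotE addr_ge0// -expr2 sqr_ge0. Qed.

Lemma edot_eq0 x : edot x x = 0 -> x = 0.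
Proof.
rewrite edotE => xx; have x0 : x 0 0 = 0 by nra.
have x1 : x 0 1 = 0 by nra.
apply/rowP => j; rewrite mxE.
by case: (unliftP 0 j) => [k ->|->//]; rewrite ord1 -[RHS]x1; congr (x _ _); apply: val_inj.
Qed.

Definition det (p q : 'rV[R]_2) : R := p 0 0 * q 0 1 - p 0 1 * q 0 0.

(* Cramer's rule expresses [det p q *: u] through [edot u p] and [edot u q]. *)
Lemma det_le_width u (p q : 'rV[R]_2) (D o : R) : edot u u = 1 ->
  `|p 0 0| <= D -> `|p 0 1| <= D -> `|q 0 0| <= D -> `|q 0 1| <= D ->
  `|edot u p| <= o -> `|edot u q| <= o -> `|det p q| <= 4 * D * o.
Proof.
move=> u1 p0 p1 q0 q1 up uq.
have D0 : 0 <= D by apply: le_trans p0.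
have o0 : 0 <= o by apply: le_trans up.
have cramer (f g f' g' : R) : `|f| <= o -> `|g| <= o -> `|f'| <= D -> `|g'| <= D ->
    `|f * f' - g * g'| <= 2 * D * o.
  move=> hf hg hf' hg'; apply: le_trans (ler_normB _ _) _; rewrite !normrM.
  have := ler_pM (normr_ge0 f) (normr_ge0 f') hf hf'.
  have := ler_pM (normr_ge0 g) (normr_ge0 g') hg hg'; lra.
have := cramer _ _ _ _ uq up p0 q0; have := cramer _ _ _ _ up uq q1 p1.
have -> : edot u p * q 0 1 - edot u q * p 0 1 = u 0 0 * det p q.
  by rewrite !edotE /det; ring.
have -> : edot u q * p 0 0 - edot u p * q 0 0 = u 0 1 * det p q.
  by rewrite !edotE /det; ring.
have b0 : 0 <= D * o by exact: mulr_ge0.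
rewrite -!(mulrA _ D o) !ler_norml.
move: (det p q) (D * o) b0 => d b b0.
move: u1; rewrite edotE.
move: (u 0 0) (u 0 1) => x y xy /andP[x1 x2] /andP[y1 y2].
have dx : (x * d) ^+ 2 <= (2 * b) ^+ 2 by nra.
have dy : (y * d) ^+ 2 <= (2 * b) ^+ 2 by nra.
(* [u] is a unit vector, so the squared bounds on the two coordinates of [d *: u] add up; 8 is then
   rounded up to the square of 4. *)
have d2 : d ^+ 2 <= 8 * b ^+ 2.
  have -> : d ^+ 2 = (x * d) ^+ 2 + (y * d) ^+ 2 by rewrite -[LHS]mul1r -xy; ring.
  by rewrite !exprMn in dx dy *; lra.
by apply/andP; split; nra.
Qed.

Lemma edot_continuous u : continuous (edot u).
Proof.
have coord i : continuous (fun y : 'rV[R]_2 => u 0 i * y 0 i).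
  move=> x; apply: (@continuousM _ _ (cst _) (fun y : 'rV[R]_2 => y 0 i)).
    exact: cst_continuous.
  exact: coord_continuous.
rewrite (_ : edot u = (fun y => u 0 0 * y 0 0) \+ (fun y => u 0 1 * y 0 1)).
  by move=> x; apply: continuousD; exact: coord.
by apply/funext => y; rewrite edotE.
Qed.

Lemma continuous_edot_affine a (b : R) : continuous (fun x => edot a x + b).
Proof.
move=> x; apply: (@continuousD _ _ _ (edot a) (cst b)); first exact: edot_continuous.
exact: cst_continuous.
Qed.

Lemma continuous_sqrD (U : topologicalType) (f g : U -> R) :
  continuous f -> continuous g -> continuous (fun t => f t * f t + g t * g t).
Proof.
move=> fc gc t; apply: (@continuousD _ _ _ (f \* f) (g \* g)).
  by apply: continuousM; exact: fc.
by apply: continuousM; exact: gc.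
Qed.

End Dot.

(** * Finite words and selection from finite sequences *)

Section Words.
Context {m : nat}.

Fixpoint words (n : nat) : seq (seq 'I_m) :=
  if n is n'.+1 then [seq i :: w | i <- enum 'I_m, w <- words n'] else [:: [::]].

Lemma mem_words n w : (w \in words n) = (size w == n).
Proof.
elim: n w => [|n IH] [|i w]; rewrite ?inE //.
  by apply/negbTE/negP => /allpairsP[[i w] /= [_ _]].
rewrite eqSS -IH; apply/allpairsP/idP => [[[j w'] /= [_ w'n [_ ->]]]//|wn].
by exists (i, w); rewrite /= mem_enum.
Qed.

Lemma sum_words (R : nmodType) n (F : seq 'I_m -> R) :
  \sum_(w <- words n.+1) F w = \sum_i \sum_(w <- words n) F (i :: w).
Proof. by rewrite /= big_allpairs_dep big_enum. Qed.

End Words.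

Lemma pigeonhole (T : eqType) (F : finType) (f : T -> F) (s : seq T) :
  uniq s -> (#|F| < size s)%N ->
  exists a b, [/\ a \in s, b \in s, a != b & f a = f b].
Proof.
move=> us sF; apply: contrapT => no.
have inj : {in s &, injective f}.
  move=> a b sa sb fab; apply/eqP; apply: contrapT => /negP ab.
  by apply: no; exists a, b.
move: sF; rewrite -(size_map f) ltnNge.
have /card_uniqP <- : uniq (map f s) by rewrite map_inj_in_uniq.
by rewrite max_card.
Qed.

Lemma arg_max_seq (R : realDomainType) (I : eqType) (s : seq I) (P : I -> Prop) (F : I -> R) :
  (exists2 i, i \in s & P i) ->
  exists i, [/\ i \in s, P i & forall j, j \in s -> P j -> F j <= F i].
Proof.
elim: s => [[i]//|a s IH] [i]; have [|no] := pselect (exists2 i, i \in s & P i).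
  move=> /IH[b [bs Pb bmax]] _ _; have [Pa|nPa] := pselect (P a); last first.
    exists b; split=> //; first by rewrite inE bs orbT.
    by move=> j; rewrite inE => /orP[/eqP -> /nPa//|]; exact: bmax.
  have [ab|ba] := leP (F a) (F b).
    exists b; split=> //; first by rewrite inE bs orbT.
    by move=> j; rewrite inE => /orP[/eqP ->//|]; exact: bmax.
  exists a; split=> //; first exact: mem_head.
  move=> j; rewrite inE => /orP[/eqP ->//|js Pj].
  by apply: le_trans (bmax j js Pj) (ltW ba).
rewrite inE => /orP[/eqP -> Pa|is' Pi]; last by exfalso; apply: no; exists i.
exists a; split=> //; first exact: mem_head.
move=> j; rewrite inE => /orP[/eqP ->//|js Pj].
by exfalso; apply: no; exists j.
Qed.

(** * Rotations of the plane and small values of the cosine *)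

Section Rotation.
Context {R : realType}.
Implicit Types (t : R) (z : 'rV[R]_2).

Definition dir t : 'rV[R]_2 := \row_j (if j == 0 then cos t else sin t).

(** Vectors are rows and matrices act on the right; with this sign convention [rot t] adds [t] to
    the angle of [dir]. *)
Definition rot t : 'M[R]_2 := \matrix_(i, j)
  if i == 0 then (if j == 0 then cos t else sin t)
  else (if j == 0 then - sin t else cos t).

Lemma ord2P (i : 'I_2) : i = 0 \/ i = 1.
Proof. by case: i => [[|[|//]] h]; [left|right]; exact: val_inj. Qed.

Lemma mulmx2E p (A : 'M[R]_(p, 2)) q (B : 'M[R]_(2, q)) i j :
  (A *m B) i j = A i 0 * B 0 j + A i 1 * B 1 j.
Proof.
rewrite mxE !big_ord_recr big_ord0 /= add0r.
by congr (_ * _ + _ * _); congr (_ _ _); exact: val_inj.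
Qed.

Lemma dir_unit t : edot (dir t) (dir t) = 1.
Proof. by rewrite edotE !mxE /= -!expr2 cos2Dsin2. Qed.

Lemma dir_rot s t : dir s *m rot t = dir (s + t).
Proof.
apply/rowP => j; rewrite mulmx2E !mxE /= cosD sinD.
by case: (ord2P j) => -> /=; ring.
Qed.

Lemma rotN t : (rot t)^T = rot (- t).
Proof.
apply/matrixP => i j; rewrite !mxE cosN sinN.
by case: (ord2P i) (ord2P j) => -> [->|->] /=; ring.
Qed.

Lemma unit_polar (a b : R) : a * a + b * b = 1 ->
  exists t, [/\ - pi <= t <= pi, a = cos t & b = sin t].
Proof.
move=> ab; have a1 : -1 <= a <= 1 by apply/andP; split; nra.
have [/andP[a0 api] ca] := acos_def a1.
have sa := sin_acos a1.
have e : 1 - a ^+ 2 = b ^+ 2 by rewrite !expr2; lra.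
rewrite e sqrtr_sqr in sa.
have [b0|b0] := leP 0 b.
  exists (acos a); split; rewrite ?ca ?sa ?ger0_norm// api andbT.
  by have := pi_ge0 R; lra.
exists (- acos a); rewrite cosN sinN ca sa ltr0_norm ?opprK//; split => //.
by apply/andP; split; have := pi_ge0 R; lra.
Qed.

Lemma unit_dir (u : 'rV[R]_2) : edot u u = 1 -> exists t, u = dir t.
Proof.
rewrite edotE => /unit_polar[t [_ u0 u1]]; exists t.
by apply/rowP => j; rewrite mxE; case: (ord2P j) => ->.
Qed.

Lemma edot_dir z : exists s, forall t, edot (dir t) z = enorm z * cos (t + s).
Proof.
have [z0|zn0] := eqVneq z 0.
  by exists 0 => t; rewrite z0 /enorm !edotE !mxE !mulr0 addr0 sqrtr0 mul0r.
have zpos : 0 < edot z z.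
  rewrite lt_neqAle edot_ge0 andbT eq_sym; apply/eqP => /edot_eq0 z0.
  by rewrite z0 eqxx in zn0.
have npos : 0 < enorm z by rewrite sqrtr_gt0.
have n2 : enorm z * enorm z = edot z z by rewrite -expr2 sqr_sqrtr ?ltW.
have [|t [_ tc ts]] := @unit_polar (z 0 0 / enorm z) (z 0 1 / enorm z).
  rewrite !mulf_div -mulrDl n2 edotE divff// -edotE gt_eqF//.
exists (- t) => s; rewrite cosD cosN sinN -tc -ts edotE !mxE /=.
by field; rewrite gt_eqF.
Qed.

(** The first row is a unit vector; the second is a unit vector orthogonal to it, so only the sign
    [(-1) ^+ d], the determinant, remains free. *)
Lemma orthogonal2_polar (M : 'M[R]_2) : M *m M^T = 1%:M ->
  exists t (d : bool), [/\ - pi <= t <= pi,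
    M 0 0 = cos t, M 0 1 = sin t,
    M 1 0 = - (-1) ^+ d * sin t & M 1 1 = (-1) ^+ d * cos t].
Proof.
move=> MM.
have e i j : M i 0 * M j 0 + M i 1 * M j 1 = (i == j)%:R.
  by have := congr1 (fun A : 'M[R]_2 => A i j) MM; rewrite mulmx2E !mxE.
have [t [tpi c s]] := unit_polar (e 0 0).
have e01 := e 0 1; have e11 := e 1 1; rewrite /= in e01 e11.
have cs : cos t * cos t + sin t * sin t = 1 by rewrite -!expr2 cos2Dsin2.
have D1 : (cos t * M 1 1 - sin t * M 1 0) ^+ 2 = 1.
  by rewrite c s in e01; rewrite expr2; nra.
exists t; move/eqP: D1; rewrite sqrf_eq1 => D.
rewrite c s in e01.
(* The second row is expanded in the orthonormal basis (cos t, sin t), (- sin t, cos t). *)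
have E10 : M 1 0 = cos t * (cos t * M 1 0 + sin t * M 1 1) -
    sin t * (cos t * M 1 1 - sin t * M 1 0) by rewrite -[LHS]mul1r -cs; ring.
have E11 : M 1 1 = sin t * (cos t * M 1 0 + sin t * M 1 1) +
    cos t * (cos t * M 1 1 - sin t * M 1 0) by rewrite -[LHS]mul1r -cs; ring.
rewrite e01 in E10 E11.
case/orP: D => /eqP D; rewrite D in E10 E11; [exists false|exists true];
  by split=> //; rewrite ?E10 ?E11 ?expr0 ?expr1; ring.
Qed.

(** [code] records the determinant and the bin of width [eta] containing the angle. With equal
    codes, the quotient has determinant 1 and an angle below [eta]. *)
Lemma small_rotation (eta : R) : 0 < eta ->
  exists (F : finType) (code : 'M[R]_2 -> F), forall A B,
    A *m A^T = 1%:M -> B *m B^T = 1%:M -> code A = code B -> A != B ->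
    exists2 b, 0 < `|b| < eta & B *m A^T = rot b.
Proof.
move=> eta0.
have total (M : 'M[R]_2) : exists td : R * bool, M *m M^T = 1%:M ->
    [/\ - pi <= td.1 <= pi, M 0 0 = cos td.1, M 0 1 = sin td.1,
      M 1 0 = - (-1) ^+ td.2 * sin td.1 & M 1 1 = (-1) ^+ td.2 * cos td.1].
  have [/orthogonal2_polar[t [d h]]|h] := pselect (M *m M^T = 1%:M).
    by exists (t, d).
  by exists (0, true).
have [f fP] := choice total.
pose bin t := Num.truncn ((t + pi) / eta).
pose N := Num.truncn (2 * pi / eta).
exists ('I_N.+1 * bool)%type, (fun M => (inord (bin (f M).1), (f M).2)).
move=> A B /fP[Api A00 A01 A10 A11] /fP[Bpi B00 B01 B10 B11] [] binE dE AB.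
have binle t : - pi <= t <= pi -> 0 <= (t + pi) / eta /\ (bin t < N.+1)%N.
  move=> tpi; have t0 : 0 <= (t + pi) / eta by apply: divr_ge0; [lra|exact: ltW].
  split=> //; rewrite ltnS; apply: le_truncn.
  by rewrite ler_pM2r ?invr_gt0//; lra.
have [A0 Ale] := binle _ Api; have [B0 Ble] := binle _ Bpi.
have {binE} binE : bin (f A).1 = bin (f B).1.
  by have := congr1 val binE; rewrite /= !inordK.
pose b := (f B).1 - (f A).1.
have beta : `|b| < eta.
  have /andP[a1 a2] := truncn_itv A0; have /andP[b1 b2] := truncn_itv B0.
  rewrite -/(bin _) binE in a1 a2; rewrite -/(bin _) in b1 b2.
  have := bin (f B).1; move: (bin _) a1 a2 b1 b2 => k.
  rewrite !ler_pdivlMr// !ltr_pdivrMr// -natr1 => a1 a2 b1 b2 _.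
  by rewrite ltr_norml /b; apply/andP; split; nra.
have b0 : b != 0.
  apply: contraNneq AB => /subr0_eq b0; apply/eqP/matrixP => i j.
  by case: (ord2P i) (ord2P j) => -> [->|->];
    rewrite ?(A00, A01, A10, A11) ?(B00, B01, B10, B11) ?dE b0.
(* When both matrices are reflections the quotient turns by [- b]. *)
exists ((-1) ^+ (f A).2 * b).
  by rewrite normrM normr_sign mul1r normr_gt0 b0.
apply/matrixP => i j; rewrite mulmx2E !mxE.
have -> : cos ((-1) ^+ (f A).2 * b) = cos b.
  by case: (f A).2; rewrite ?expr1 ?mulN1r ?cosN// expr0 mul1r.
have -> : sin ((-1) ^+ (f A).2 * b) = (-1) ^+ (f A).2 * sin b.
  by case: (f A).2; rewrite ?expr1 ?mulN1r ?sinN// expr0 !mul1r.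
rewrite /b sinB cosB.
have d2 : (-1) ^+ (f A).2 * (-1) ^+ (f A).2 = 1 :> R.
  by rewrite -signr_addb addbb.
move: d2; case: (ord2P i) (ord2P j) => -> [->|->] /=;
  rewrite ?(A00, A01, A10, A11) ?(B00, B01, B10, B11) -?dE;
  move: ((-1) ^+ _) => d d2; first [ring | by rewrite -[RHS]mul1r -d2; ring].
Qed.

Lemma cos_zero t : exists2 s, t <= s <= t + pi & cos s = 0.
Proof.
have := @IVT R cos t (t + pi) 0; case.
- by have := pi_ge0 R; lra.
- exact/continuous_subspaceT/continuous_cos.
- rewrite cosDpi; case: (leP 0 (cos t)) => h; rewrite ge_min le_max; lra.
by move=> s; rewrite in_itv /= => st s0; exists s.
Qed.

Lemma cos_lipschitz s t : cos s = 0 -> s <= t -> `|cos t| <= t - s.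
Proof.
move=> s0 st.
have [c _ e] := @MVT_segment R cos (fun x => - sin x) s t st
  (fun x _ => is_derive_cos x) (continuous_subspaceT (@continuous_cos R)).
rewrite -[cos t]subr0 -s0 e normrM normrN (ger0_norm (_ : 0 <= t - s)) ?subr_ge0//.
by rewrite ler_piMl ?subr_ge0// sin_max.
Qed.

(** The progression is long enough to pass a zero [s] of the cosine. The cosine being 1-Lipschitz,
    the roughly [kappa / b] terms that follow [s] all have values of size at most [kappa]. *)
Lemma cos_small_count (phi b kappa : R) (N : nat) :
  0 < b -> b <= kappa -> kappa <= 1 -> 6 <= N%:R * b ->
  kappa / (2 * b) <= \sum_(k < N) ((`|cos (phi + k%:R * b)| <= kappa)%R : nat)%:R.
Proof.
move=> b0 bk k1 Nb; have [s /andP[sphi spi] s0] := cos_zero phi.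
have sb : 0 <= (s - phi) / b by apply: divr_ge0; [rewrite subr_ge0|exact: ltW].
have kb : 0 <= kappa / b by apply: divr_ge0; [lra|exact: ltW].
have /andP[] := truncn_itv sb; rewrite ler_pdivlMr// ltr_pdivrMr//.
(* [k0] is the first index whose angle exceeds [s]; the [n] indices from [k0] on have angles at most
   [kappa] beyond [s]. *)
set k0 := (Num.truncn ((s - phi) / b)).+1 => k0l k0g.
have /andP[] := truncn_itv kb.
set n := Num.truncn _; rewrite ler_pdivlMr// ltr_pdivrMr// => nl ng.
have k0l' : k0%:R * b <= s - phi + b.
  by rewrite -natr1 mulrDl mul1r lerD2r.
have n1 : (1 <= n)%N by rewrite truncn_gt0 ler_pdivlMr// mul1r.
have pi4 : pi <= 4 :> R by have := @pihalf_lt2 R; lra.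
(* These indices fit because [pi + b + kappa] is at most 4 + 1 + 1. *)
have k0nN : (k0 + n <= N)%N.
  rewrite -(ler_nat R) -(ler_pM2r b0) natrD; apply: le_trans Nb.
  rewrite mulrDl; lra.
(* As [n] is at least 1, [kappa / b < n + 1 <= 2 * n]; hence the factor 2. *)
apply: (@le_trans _ _ n%:R).
  rewrite ler_pdivrMr ?mulr_gt0//.
  have : 1 <= n%:R :> R by rewrite ler1n.
  move: ng; rewrite -natr1; nra.
rewrite -(big_mkord xpredT (fun k => ((`|cos (phi + k%:R * b)| <= kappa)%R : nat)%:R)).
rewrite (big_cat_nat (n := k0)) ?(leq_trans (leq_addr _ _) k0nN)//=.
rewrite (big_cat_nat (n := k0 + n) (m := k0)) ?leq_addr//=.
have -> : \sum_(k0 <= k < k0 + n) ((`|cos (phi + k%:R * b)| <= kappa)%R : nat)%:R = n%:R :> R.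
  rewrite (eq_big_nat _ _ (F2 := fun=> 1)); first by rewrite sumr_const_nat addnC addnK.
  move=> k /andP[k0k kn]; suff -> : `|cos (phi + k%:R * b)| <= kappa by [].
  have klb : k0%:R * b <= k%:R * b by rewrite ler_pM2r// ler_nat.
  have kub : k%:R * b + b <= k0%:R * b + n%:R * b.
    by rewrite -mulrDl -natrD -{2}[b]mul1r -mulrDl natr1 ler_pM2r// ler_nat.
  apply: le_trans (cos_lipschitz s0 _) _; lra.
rewrite addrCA lerDl addr_ge0//; apply: sumr_ge0 => k _; exact: ler0n.
Qed.

(** As the direction turns, the component of [z] is [enorm z <= Z] times a cosine, so [z] lies in
    the strip whenever that cosine is at most [rho / Z] in absolute value. *)
Lemma thin_strip_count z (a b rho Z : R) (N : nat) :
  0 < `|b| -> 0 < Z -> `|b| <= rho / Z -> rho / Z <= 1 -> 6 <= N%:R * `|b| ->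
  (forall t, edot (dir t) z <= Z) ->
  rho / Z / (2 * `|b|) <=
    \sum_(k < N) ((`|edot (dir (a + k%:R * b)) z| <= rho)%R : nat)%:R.
Proof.
move=> b0 Z0 bk k1 Nb zZ; have [s zE] := edot_dir z.
have zn : enorm z <= Z.
  by have := zZ (- s); rewrite zE addNr cos0 mulr1.
(* The cosine is even, so a progression with negative step is reflected to one with step [|b|]. *)
pose phi := if 0 <= b then a + s else - (a + s).
apply: le_trans (cos_small_count phi b0 bk k1 Nb) _.
apply: ler_sum => k _; rewrite ler_nat.
have [ck|//] := boolP (`|cos (phi + k%:R * `|b|)| <= rho / Z).
suff -> : `|edot (dir (a + k%:R * b)) z| <= rho by [].
rewrite zE normrM ger0_norm ?sqrtr_ge0//.
have -> : `|cos (a + k%:R * b + s)| = `|cos (phi + k%:R * `|b|)|.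
  rewrite /phi; case: (leP 0 b) => b0'.
    by rewrite (ger0_norm b0'); congr `|cos _|; ring.
  by rewrite (ltr0_norm b0') -[in LHS]cosN; congr `|cos _|; ring.
apply: (@le_trans _ _ (Z * (rho / Z))); last by rewrite mulrCA divff ?mulr1 ?gt_eqF.
by apply: ler_pM => //; rewrite sqrtr_ge0.
Qed.

End Rotation.

(** * Iterated function systems *)

Section Hausdorff.
Context {R : realType}.

Lemma ediam_ge0 (A : set 'rV[R]_2) : (0 <= ediam A)%E.
Proof. by apply: ereal_sup_ubound; left. Qed.

Lemma ediam_dist (A : set 'rV[R]_2) x y :
  A x -> A y -> ((enorm (x - y))%:E <= ediam A)%E.
Proof. by move=> Ax Ay; apply: ereal_sup_ubound; right; exists (x, y). Qed.

Lemma ediam_le_dist (A : set 'rV[R]_2) (M : \bar R) : (0 <= M)%E ->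
  (forall x y, A x -> A y -> ((enorm (x - y))%:E <= M)%E) -> (ediam A <= M)%E.
Proof.
move=> M0 AM; apply: ge_ereal_sup => _ [->//|[[x y] /= [Ax Ay] <-]].
exact: AM.
Qed.

Lemma hausdorff1_delta_ge0 (delta : R) (A : set 'rV[R]_2) :
  (0 <= hausdorff1_delta delta A)%E.
Proof.
apply: le_ereal_inf_tmp => _ [U _ <-].
by apply: nneseries_ge0 => k _ _; exact: ediam_ge0.
Qed.

Lemma hausdorff1_set1 (x : 'rV[R]_2) : hausdorff1 [set x] = 0%E.
Proof.
have diam0 (A : set 'rV[R]_2) : A `<=` [set x] -> ediam A = 0%E.
  move=> Ax; apply/eqP; rewrite eq_le ediam_ge0 andbT.
  apply: ediam_le_dist => // y z /Ax -> /Ax ->.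
  by rewrite subrr /enorm edotE !mxE mul0r addr0 sqrtr0.
apply/eqP; rewrite eq_le; apply/andP; split; last first.
  apply: le_trans (hausdorff1_delta_ge0 1 [set x]) _.
  by apply: ereal_sup_ubound; exists 1 => //=.
apply: ge_ereal_sup => _ [d /= d0 <-]; apply: ereal_inf_lbound.
exists (fun=> [set x]) => /=.
  by split => [y ->|k]; [exists 0%N|rewrite diam0// lee_fin ltW].
by apply: eseries0 => k _ _; rewrite diam0.
Qed.

End Hausdorff.

(** * Words, cylinders and shadows of the attractor *)

Section IFS.
Context {R : realType} {m : nat}.
Variables (S : 'I_m -> 'rV[R]_2 -> 'rV[R]_2) (K : set 'rV[R]_2).
Variables (r : 'I_m -> R) (T : 'I_m -> 'M[R]_2) (v : 'I_m -> 'rV[R]_2).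
Hypothesis SE : forall i x, S i x = r i *: (x *m T i) + v i.
Hypothesis r01 : forall i, 0 < r i < 1.
Hypothesis TT : forall i, T i *m (T i)^T = 1%:M.
Hypothesis attrK : attractor S K.
Implicit Types (u x y : 'rV[R]_2) (w : seq 'I_m).

Definition wmap w x := foldr S x w.
Definition wratio w : R := \prod_(i <- w) r i.
(** For row vectors the letter applied first stands leftmost, so [wrot] reverses concatenation. *)
Definition wrot w : 'M[R]_2 := foldr (fun i M => M *m T i) 1%:M w.

Lemma wmap_cat a b x : wmap (a ++ b) x = wmap a (wmap b x).
Proof. by rewrite /wmap foldr_cat. Qed.

Lemma wratio_cons i w : wratio (i :: w) = r i * wratio w.
Proof. by rewrite /wratio big_cons. Qed.

Lemma wratio_cat a b : wratio (a ++ b) = wratio a * wratio b.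
Proof. by rewrite /wratio big_cat. Qed.

Lemma wrot_cat a b : wrot (a ++ b) = wrot b *m wrot a.
Proof. by elim: a => [|i a IH] /=; rewrite ?mulmx1// IH mulmxA. Qed.

Lemma wratio_gt0 w : 0 < wratio w.
Proof. by apply: prodr_gt0 => i _; have /andP[] := r01 i. Qed.

Lemma wratio_lt1 w : w != [::] -> wratio w < 1.
Proof.
have le1 w' : wratio w' <= 1.
  elim: w' => [|i w' IH]; first by rewrite /wratio big_nil.
  by rewrite wratio_cons; have := wratio_gt0 w'; have /andP[] := r01 i; nra.
case: w => // i w _; rewrite wratio_cons.
have := le1 w; have := wratio_gt0 w; have /andP[] := r01 i; nra.
Qed.

Lemma wrot_orth w : wrot w *m (wrot w)^T = 1%:M.
Proof.
elim: w => [|i w IH] /=; first by rewrite trmx1 mulmx1.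
by rewrite trmx_mul mulmxA -(mulmxA (wrot w)) TT mulmx1.
Qed.

Lemma wmapB w x y : wmap w x - wmap w y = wratio w *: ((x - y) *m wrot w).
Proof.
elim: w => [|i w IH] /=; first by rewrite /wratio big_nil scale1r mulmx1.
rewrite !SE opprD addrACA subrr addr0 -scalerBr -mulmxBl IH wratio_cons.
by rewrite -scalemxAl scalerA mulmxA.
Qed.

(** This turns projections of cylinders into rescaled projections of [K] in rotated directions. *)
Lemma edot_wmapB u w x y :
  edot u (wmap w x) - edot u (wmap w y) =
  wratio w * (edot (u *m (wrot w)^T) x - edot (u *m (wrot w)^T) y).
Proof. by rewrite -!edotBr wmapB edotZr edot_mulmx. Qed.

Lemma unit_wrot u w : edot u u = 1 -> 
  edot (u *m (wrot w)^T) (u *m (wrot w)^T) = 1.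
Proof. by move=> u1; rewrite edot_orth ?wrot_orth. Qed.

Lemma wmap_attractor w x : K x -> K (wmap w x).
Proof.
move=> Kx; elim: w => //= i w IH; have [_ _ ->] := attrK.
by exists i => //; exists (wmap w x).
Qed.

Lemma attractor_words n x : K x ->
  exists w y, [/\ size w = n, K y & x = wmap w y].
Proof.
elim: n x => [|n IH] x Kx; first by exists [::], x.
have [_ _ KE] := attrK; move: Kx; rewrite {1}KE => -[i _ [y Ky <-]].
by have [w [z [wn Kz ->]]] := IH _ Ky; exists (i :: w), z; rewrite /= wn.
Qed.

Lemma sum_wratio n : \sum_(w <- words n) wratio w = (\sum_i r i) ^+ n.
Proof.
elim: n => [|n IH]; first by rewrite /= big_seq1 /wratio big_nil expr0.
rewrite sum_words exprS -IH mulr_suml; apply: eq_bigr => i _.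
by rewrite mulr_sumr; apply: eq_bigr => w _; rewrite wratio_cons.
Qed.

(** By the Cauchy-Schwarz inequality, the maximum of [edot x x] on the compact set [K] bounds the
    projections uniformly in [u]. *)
Lemma attractor_width :
  exists2 D : R, 0 < D & forall u x y, edot u u = 1 -> K x -> K y ->
    `|edot u x - edot u y| <= D.
Proof.
have [K0 Kc _] := attrK.
have sqc : {within K, continuous (fun x : 'rV[R]_2 => edot x x)}.
  apply: continuous_subspaceT; under eq_fun do rewrite edotE.
  by apply: continuous_sqrD => x; exact: coord_continuous.
have [z _ zmax] := EVT_max_rV K0 Kc sqc.
(* The added 1 makes [M] at least 1, so this bound on squares also bounds absolute values. *)
pose M := edot z z + 1; have M1 : 1 <= M by rewrite lerDr edot_ge0.
have bound u x : edot u u = 1 -> K x -> `|edot u x| <= M.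
  move=> u1 Kx; have xM : edot x x <= M.
    by apply: le_trans (zmax x (mem_set Kx)) _; rewrite lerDl.
  have : edot u x ^+ 2 <= M ^+ 2.
    apply: (@le_trans _ _ (edot u u * edot x x)); last by rewrite u1; nra.
    rewrite !edotE; have := sqr_ge0 (u 0 0 * x 0 1 - u 0 1 * x 0 0); nra.
  by move=> eM; rewrite ler_norml; apply/andP; split; nra.
exists (2 * M); first by lra.
move=> u x y u1 Kx Ky; apply: le_trans (ler_normB _ _) _.
by have := bound u x u1 Kx; have := bound u y u1 Ky; lra.
Qed.

Definition shadow u : set R := [set edot u x | x in K].
Definition shadow_content u : R := content (shadow u).

Lemma coverable_shadow u : edot u u = 1 -> coverable (shadow u).
Proof.
move=> u1; have [D D0 KD] := attractor_width.
have [[x0 Kx0] _ _] := attrK.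
apply: (@coverable_itv _ _ (edot u x0 - D) (edot u x0 + D + 1)).
move=> _ [x Kx <-]; have := KD u x x0 u1 Kx Kx0; rewrite ler_norml; lra.
Qed.

(** Subadditivity over the cylinders of length [n]. Those in [V] are left out, each of their
    projected points lying in [B] or in the projection of a retained cylinder. [B] is an interval
    around a strip in one application; in another it is empty and [V] is a single redundant
    cylinder. *)
Lemma shadow_content_words u n (V : pred (seq 'I_m)) (B : set R) :
  edot u u = 1 -> coverable B ->
  (forall w x, size w = n -> V w -> K x -> B (edot u (wmap w x)) \/
    exists q y, [/\ size q = n, ~~ V q, K y & edot u (wmap w x) = edot u (wmap q y)]) ->
  shadow_content u <= content B +
    \sum_(w <- words n | ~~ V w) wratio w * shadow_content (u *m (wrot w)^T).
Proof.
move=> u1 cB VB.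
pose F w := [set edot u (wmap w x) | x in K].
have FE w : F w =
    [set wratio w * t + edot u (wmap w 0) | t in shadow (u *m (wrot w)^T)].
  have E x : edot u (wmap w x) =
      wratio w * edot (u *m (wrot w)^T) x + edot u (wmap w 0).
    by have := edot_wmapB u w x 0; rewrite !edotE !mxE; lra.
  apply/seteqP; split => t /=.
    by move=> [x Kx <-]; exists (edot (u *m (wrot w)^T) x); [exists x|].
  by move=> [_ [x Kx <-] <-]; exists x.
have Fle w := content_affine (edot u (wmap w 0)) (wratio_gt0 w)
  (coverable_shadow (unit_wrot w u1)).
have [|cU Ule] := @content_bigU R _ [seq w <- words n | ~~ V w] F.
  by move=> w _; rewrite FE; exact: (Fle w).1.
have [cBU BUle] := content_setU cB cU.
apply: le_trans (content_sub cBU _) _; last first.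
  apply: le_trans BUle _; rewrite lerD2l; apply: le_trans Ule _.
  by rewrite big_filter; apply: ler_sum => w _; rewrite FE; exact: (Fle w).2.
move=> _ [x Kx <-]; have [w [y [wn Ky ->]]] := attractor_words n Kx.
have [Vw|nVw] := boolP (V w).
  have [|[q [z [qn nVq Kz ->]]]] := VB w y wn Vw Ky; first by left.
  by right; exists q; [rewrite mem_filter nVq mem_words qn eqxx|exists z].
by right; exists w; [rewrite mem_filter nVw mem_words wn eqxx|exists y].
Qed.

Lemma shadow_content_step u : edot u u = 1 ->
  shadow_content u <= \sum_j r j * shadow_content (u *m (T j)^T).
Proof.
move=> u1; have [c0 E0] := @content_set0 R.
have := @shadow_content_words u 1 xpred0 set0 u1 c0
  (fun _ _ _ H => False_ind _ (Bool.diff_false_true H)).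
rewrite E0 add0r sum_words => h; apply: (le_trans h).
by apply: ler_sum => j _; rewrite /= big_seq1 /wratio big_seq1 /= mul1mx.
Qed.

Lemma enorm_similarity i x y : enorm (S i x - S i y) = r i * enorm (x - y).
Proof.
have ri : 0 <= r i by have /andP[/ltW] := r01 i.
rewrite !SE opprD addrACA subrr addr0 -scalerBr -mulmxBl /enorm.
rewrite edotZr edotZl edot_mulmx -mulmxA TT mulmx1 mulrA -expr2.
by rewrite sqrtrM ?sqr_ge0// sqrtr_sqr ger0_norm.
Qed.

(** The squared distance between two pieces attains its minimum over the compact product of [K] with
    itself, and disjointness makes it positive; there are finitely many pairs. *)
Lemma separated_pieces : strong_separation S K -> exists2 d : R, 0 < d &
  forall i j x y, i != j -> K x -> K y -> d < enorm (S i x - S j y).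
Proof.
move=> sepS; have [K0 Kc KE] := attrK.
have Scoord i (k : 'I_2) : exists a b, forall x, S i x 0 k = edot a x + b.
  exists (r i *: (col k (T i))^T), (v i 0 k) => x.
  rewrite SE !mxE edotZl edotC; congr (_ * _ + _).
  by apply: eq_bigr => j _; rewrite !mxE.
have pos (p : 'I_m * 'I_m) : exists d : R, 0 < d /\ forall x y, p.1 != p.2 ->
    K x -> K y -> d < enorm (S p.1 x - S p.2 y).
  case: p => i j /=; have [/eqP->|ij] := boolP (i == j); first by exists 1; split.
  pose f (p : 'rV[R]_2 * 'rV[R]_2) := edot (S i p.1 - S j p.2) (S i p.1 - S j p.2).
  have fc : continuous f.
    have [a0 [b0 E0]] := Scoord i 0; have [a1 [b1 E1]] := Scoord i 1.
    have [c0 [d0 F0]] := Scoord j 0; have [c1 [d1 F1]] := Scoord j 1.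
    pose g a b c d (p : 'rV[R]_2 * 'rV[R]_2) := (edot a p.1 + b) - (edot c p.2 + d).
    have gc a b c d : continuous (g a b c d).
      move=> p; apply: (@continuousB _ _ _ ((fun x => edot a x + b) \o fst)
        ((fun x => edot c x + d) \o snd)).
        by apply: continuous_comp; [exact: cvg_fst|exact: continuous_edot_affine].
      by apply: continuous_comp; [exact: cvg_snd|exact: continuous_edot_affine].
    rewrite (_ : f = fun p => g a0 b0 c0 d0 p * g a0 b0 c0 d0 p +
        g a1 b1 c1 d1 p * g a1 b1 c1 d1 p); first exact: continuous_sqrD.
    by apply/funext => p; rewrite /f edotE !mxE E0 E1 F0 F1.
  have KK0 : K `*` K !=set0 by case: K0 => x Kx; exists (x, x).
  have [[x y] /set_mem[/= Kx Ky] fmin] :=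
    compact_EVT_min KK0 (compact_setX Kc Kc) (continuous_subspaceT fc).
  have fpos : 0 < f (x, y).
    rewrite lt_neqAle edot_ge0 andbT eq_sym; apply/eqP => /edot_eq0 /= /subr0_eq Sxy.
    move/trivIsetP: sepS => /(_ i j Logic.I Logic.I ij); apply/eqP/set0P.
    by exists (S i x); split; [exists x|exists y].
  (* Halving the minimal distance makes the inequality strict. *)
  exists (Num.sqrt (f (x, y)) / 2); split; first by rewrite divr_gt0// sqrtr_gt0.
  move=> x' y' _ Kx' Ky'.
  have : Num.sqrt (f (x, y)) <= enorm (S i x' - S j y').
    by rewrite ler_wsqrtr//; apply: (fmin (x', y')); apply/mem_set.
  have : 0 < Num.sqrt (f (x, y)) by rewrite sqrtr_gt0.
  lra.
have [d dP] := choice pos.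
exists (\big[Order.min/1]_p d p).
  by apply: lt_bigmin => // p _; exact: (dP p).1.
move=> i j x y ij Kx Ky; apply: le_lt_trans ((dP (i, j)).2 x y ij Kx Ky).
exact: (bigmin_le_cond _ _ (j := (i, j))).
Qed.

(* Pulling back by [S i] the sets of a fine cover of [K] gives a cover of [K],
   and by separation each set of the original cover is used for at most one [i]. *)
Lemma hausdorff1_superadditive (delta : R) : strong_separation S K -> 0 < delta ->
  ((\sum_i r i)%:E * hausdorff1_delta delta K <= hausdorff1 K)%E.
Proof.
move=> /separated_pieces[d d0 sepd] delta0.
have rgt0 i : 0 < r i by have /andP[] := r01 i.
(* A set of diameter at most [d] cannot meet two pieces; one of diameter at most [r i * delta] has a
   pullback of diameter at most [delta]. *)
pose d' := Num.min d (\big[Order.min/1]_i (r i * delta)).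
have d'0 : 0 < d'.
  rewrite lt_min d0/=; apply: lt_bigmin => // i _; exact: mulr_gt0.
have d'd : d' <= d by rewrite ge_min lexx.
have d'r i : d' <= r i * delta.
  by rewrite ge_min; apply/orP; right; exact: bigmin_le_cond.
apply: (@le_trans _ _ (hausdorff1_delta d' K)); last first.
  by apply: ereal_sup_ubound; exists d'.
apply: le_ereal_inf_tmp => _ [U [KU Ud] <-].
pose V i k := [set x | K x /\ U k (S i x)].
have Vdiam i k : ((r i)%:E * ediam (V i k) <= ediam (U k))%E.
  rewrite -lee_pdivlMl//; apply: ediam_le_dist.
    by rewrite mule_ge0 ?ediam_ge0// lee_fin invr_ge0 ltW.
  move=> x y [_ Ux] [_ Uy]; rewrite lee_pdivlMl// -EFinM -enorm_similarity.
  exact: ediam_dist.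
have VK i : (hausdorff1_delta delta K <= \sum_(0 <= k <oo) ediam (V i k))%E.
  apply: ereal_inf_lbound; exists (V i) => //; split.
    move=> x Kx; have [|k _ Uk] := KU (S i x); last by exists k.
    by have [_ _ ->] := attrK; exists i => //; exists x.
  move=> k; have : ((r i)%:E * ediam (V i k) <= (r i)%:E * delta%:E)%E.
    apply: le_trans (Vdiam i k) _; apply: le_trans (Ud k) _.
    by rewrite -EFinM lee_fin.
  by rewrite lee_pmul2l// lte_fin.
have Vempty i j k x : V i k x -> i != j -> ediam (V j k) = 0%E.
  move=> [Kx Ux] ij; apply/eqP; rewrite eq_le ediam_ge0 andbT.
  apply: ediam_le_dist => // y z [Ky Uy]; exfalso.
  have := le_trans (ediam_dist Ux Uy) (Ud k); rewrite lee_fin leNgt.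
  by move=> /negP; apply; apply: le_lt_trans d'd _; exact: sepd.
have Vsum k : (\sum_i (r i)%:E * ediam (V i k) <= ediam (U k))%E.
  have [[i [x Vx]]|Vno] := pselect (exists i, V i k !=set0).
    rewrite (bigD1 i)//= big1 ?adde0//.
    by move=> j ji; rewrite (Vempty i j k x)// ?mule0// eq_sym.
  rewrite big1 ?ediam_ge0// => i _; suff -> : ediam (V i k) = 0%E by rewrite mule0.
  apply/eqP; rewrite eq_le ediam_ge0 andbT.
  by apply: ediam_le_dist => // x y Vx; exfalso; apply: Vno; exists i, x.
apply: (@le_trans _ _ (\sum_i (r i)%:E * \sum_(0 <= k <oo) ediam (V i k))%E).
  rewrite -sumEFin ge0_sume_distrl; last by move=> i _; rewrite lee_fin ltW.
  by apply: lee_sum => i _; rewrite lee_wpmul2l// lee_fin ltW.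
under eq_bigr => i _.
  rewrite -nneseriesZl; last by move=> k _; exact: ediam_ge0.
  over.
rewrite -nneseries_sum; last first.
  by move=> i k _; rewrite mule_ge0 ?ediam_ge0// lee_fin ltW.
apply: lee_nneseries => k; last by move=> _; exact: Vsum.
by move=> _ _; apply: sume_ge0 => i _; rewrite mule_ge0 ?ediam_ge0// lee_fin ltW.
Qed.

(** If the sum [q] exceeded 1, the supremum over [delta] in superadditivity would bound the measure
    of [K] by itself divided by [q]. *)
Lemma sum_ratio_le1 : strong_separation S K -> one_set K -> \sum_i r i <= 1.
Proof.
move=> sepS /andP[H0 Hoo]; rewrite leNgt; apply/negP => q1.
set q := \sum_i r i in q1 *; have q0 : 0 < q by lra.
have Hfin : hausdorff1 K \is a fin_num by rewrite gt0_fin_numE.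
have : (hausdorff1 K <= q^-1%:E * hausdorff1 K)%E.
  apply: ge_ereal_sup => _ [delta /= delta0 <-].
  by rewrite lee_pdivlMl//; exact: hausdorff1_superadditive.
rewrite -(fineK Hfin) -EFinM lee_fin ler_pdivlMl//.
have : 0 < fine (hausdorff1 K) by rewrite fine_gt0// H0.
nra.
Qed.

Section RatioSum.
Hypothesis r_le1 : \sum_i r i <= 1.

(* A direction in which the shadow is nearly maximal forces the same in all
   the directions in which the pieces of [K] are seen. *)
Lemma shadow_content_defect (X : set 'rV[R]_2) (c : R) u w :
  (forall x i, X x -> X (x *m (T i)^T)) ->
  (forall x, X x -> edot x x = 1 /\ shadow_content x <= c) ->
  X u -> wratio w * (c - shadow_content (u *m (wrot w)^T)) <= c - shadow_content u.
Proof.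
move=> XT Xc; have c0 x : X x -> 0 <= c.
  by move=> /Xc[_]; apply: le_trans; exact: content_ge0.
elim: w u => [|i w IH] u Xu.
  by rewrite /wratio big_nil mul1r trmx1 mulmx1.
have /= := IH _ (XT _ i Xu); rewrite trmx_mul mulmxA wratio_cons => IHw.
have ri := r01 i; apply: (@le_trans _ _ (r i * (c - shadow_content (u *m (T i)^T)))).
  by rewrite -mulrA; case/andP: ri => ri0 _; rewrite ler_pM2l.
have step := shadow_content_step (Xc _ Xu).1.
have : r i * (c - shadow_content (u *m (T i)^T)) <=
    \sum_j r j * (c - shadow_content (u *m (T j)^T)).
  rewrite (bigD1 i)//= lerDl; apply: sumr_ge0 => j _.
  apply: mulr_ge0; first by have /andP[/ltW] := r01 j.
  by rewrite subr_ge0; exact: (Xc _ (XT _ j Xu)).2.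
have -> : \sum_j r j * (c - shadow_content (u *m (T j)^T)) =
    (\sum_j r j) * c - \sum_j r j * shadow_content (u *m (T j)^T).
  by rewrite mulr_suml -sumrB; apply: eq_bigr => j _; rewrite mulrBr.
have := ler_wpM2r (c0 _ Xu) r_le1; rewrite mul1r; lra.
Qed.

Lemma wmap_affine w x : wmap w x = wmap w 0 + wratio w *: (x *m wrot w).
Proof. by rewrite -[wmap w x](subrK (wmap w 0)) wmapB subr0 addrC. Qed.

(** A point of [K] minimizing the distance to its image is fixed: its image is again in [K] and has
    that distance multiplied by [wratio w], which is below 1. *)
Lemma wmap_fixed_point w : w != [::] -> exists2 p, K p & wmap w p = p.
Proof.
move=> wn; have [K0 Kc _] := attrK.
have coord (k : 'I_2) : exists a b, forall x, (x - wmap w x) 0 k = edot a x + b.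
  exists (delta_mx 0 k - wratio w *: (col k (wrot w))^T), (- wmap w 0 0 k) => x.
  rewrite wmap_affine edotE; have := mulmx2E x (wrot w) 0 k.
  move: (x *m wrot w) => M ME; rewrite !mxE ME /=.
  by case: (ord2P k) => -> /=; ring.
pose f x := edot (x - wmap w x) (x - wmap w x).
have fc : continuous f.
  have [a0 [b0 E0]] := coord 0; have [a1 [b1 E1]] := coord 1.
  rewrite (_ : f = fun x => (edot a0 x + b0) * (edot a0 x + b0) +
      (edot a1 x + b1) * (edot a1 x + b1)).
    by apply: continuous_sqrD; exact: continuous_edot_affine.
  by apply/funext => x; rewrite /f edotE E0 E1.
have [p /set_mem Kp pmin] := EVT_min_rV K0 Kc (continuous_subspaceT fc).
exists p => //; apply/esym/eqP; rewrite -subr_eq0; apply/eqP/edot_eq0.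
have : f (wmap w p) = wratio w ^+ 2 * f p.
  by rewrite /f wmapB edotZr edotZl edot_mulmx -mulmxA wrot_orth mulmx1 mulrA expr2.
have := pmin _ (mem_set (wmap_attractor w Kp)).
have q1 : wratio w ^+ 2 < 1.
  by have := wratio_gt0 w; have := wratio_lt1 wn; rewrite expr2; nra.
rewrite -/(f p) => le eq; rewrite eq in le.
by apply/eqP; rewrite eq_le edot_ge0 andbT -/(f p); nra.
Qed.

Definition wpow k w := flatten (nseq k w) : seq 'I_m.

Lemma wrot_pow k w : wrot (wpow k w) = wrot w ^+ k.
Proof. by elim: k => [|k IH] //; rewrite [wpow _ _]/= wrot_cat IH exprSr. Qed.

Lemma wratio_pow k w : wratio (wpow k w) = wratio w ^+ k.
Proof.
elim: k => [|k IH]; first by rewrite /wratio big_nil.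
by rewrite [wpow _ _]/= wratio_cat IH exprS.
Qed.

(** The rotation parts of words form a semigroup; finite order is what provides inverses inside
    it. *)
Lemma finite_order_inverse w k : (0 < k)%N -> wrot w ^+ k = 1 ->
  wrot (wpow k.-1 w) = (wrot w)^T.
Proof.
move=> k0 wk; rewrite wrot_pow -[LHS]mulmx1 -(wrot_orth w) mulmxA mulmxE.
by rewrite -exprSr prednK// wk mul1r.
Qed.

Lemma wrot_expB w a b : (a <= b)%N ->
  wrot w ^+ b *m (wrot w ^+ a)^T = wrot w ^+ (b - a).
Proof.
move=> ab; rewrite -{1}(subnK ab) exprD -mulmxE -mulmxA -(wrot_pow a) wrot_orth.
by rewrite mulmx1.
Qed.

(** If some rotation part has infinite order, two of its powers share a code and their quotient is
    again a power. Otherwise inverses are rotation parts of words, and two distinct rotation parts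
    with a common code have a quotient of the required kind. *)
Lemma infinite_rotations_small (eta : R) :
  (forall G : seq 'M[R]_2, exists w, wrot w \notin G) -> 0 < eta ->
  exists w b, 0 < `|b| < eta /\ wrot w = rot b.
Proof.
move=> inf /small_rotation[F [code codeP]].
have [[w wk]|fin] := pselect (exists w, forall k, (0 < k)%N -> wrot w ^+ k <> 1).
  have orth k : wrot w ^+ k *m (wrot w ^+ k)^T = 1%:M.
    by rewrite -wrot_pow wrot_orth.
  have [|i [j [_ _ ij cij]]] :=
    @pigeonhole _ F (fun k => code (wrot w ^+ k)) (iota 0 #|F|.+1) (iota_uniq _ _).
    by rewrite size_iota.
  have main a b : (a < b)%N -> code (wrot w ^+ a) = code (wrot w ^+ b) ->
      exists w b, 0 < `|b| < eta /\ wrot w = rot b.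
    move=> ab cab; have [|t teta tE] := codeP _ _ (orth a) (orth b) cab.
      apply/eqP => e; apply: (wk (b - a)%N); first by rewrite subn_gt0.
      by rewrite -(wrot_expB _ (ltnW ab)) -e orth.
    exists (wpow (b - a) w), t; split=> //.
    by rewrite wrot_pow -tE wrot_expB// ltnW.
  by case: (ltngtP i j) ij => // h _; [exact: main h _|exact: main h (esym cij)].
have inverse w : exists w', wrot w' = (wrot w)^T.
  have [k [k0 wk]] : exists k, (0 < k)%N /\ wrot w ^+ k = 1.
    apply: contrapT => no; apply: fin; exists w => k k0 wk; apply: no.
    by exists k.
  by exists (wpow k.-1 w); exact: finite_order_inverse.
have many n : exists s : seq 'M[R]_2,
    [/\ size s = n, uniq s & forall A, A \in s -> exists w, A = wrot w].
  elim: n => [|n [s [sn us sw]]]; first by exists [::].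
  have [w ws] := inf s; exists (wrot w :: s); rewrite /= sn ws us; split => // A.
  by rewrite inE => /orP[/eqP ->|/sw//]; exists w.
have [s [sF us sw]] := many #|F|.+1.
have [|A [B [/sw[a ->] /sw[b ->] AB cAB]]] := @pigeonhole _ F code s us.
  by rewrite sF.
have [t teta tE] := codeP _ _ (wrot_orth a) (wrot_orth b) cAB AB.
have [a' a'E] := inverse a.
by exists (a' ++ b), t; rewrite wrot_cat a'E.
Qed.

Lemma shadow_content_le u D : edot u u = 1 ->
  (forall u x y, edot u u = 1 -> K x -> K y -> `|edot u x - edot u y| <= D) ->
  0 <= D -> shadow_content u <= 2 * D + 1.
Proof.
move=> u1 KD D0; have [[x Kx] _ _] := attrK.
apply: (@le_trans _ _ ((edot u x + D + 1) - (edot u x - D))); last by lra.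
apply: content_itv_le; first by lra.
move=> _ [y Ky <-]; have := KD u y x u1 Ky Kx; rewrite ler_norml; lra.
Qed.

(** * Distance from a fixed point, and the energy sum *)

Section LeadingLetters.
Variables (i0 : 'I_m) (x0 : 'rV[R]_2) (D : R).
Hypothesis Kx0 : K x0.
Hypothesis fix0 : S i0 x0 = x0.
Hypothesis KD : forall u x y, edot u u = 1 -> K x -> K y ->
  `|edot u x - edot u y| <= D.
Hypothesis max0 : forall i, r i <= r i0.

Fixpoint lead w : nat :=
  if w is i :: w' then (if i == i0 then (lead w').+1 else 0%N) else 0%N.

Lemma lead_size w : (lead w <= size w)%N.
Proof. by elim: w => //= i w IH; case: eqP. Qed.

Lemma wratio_max w : wratio w <= r i0 ^+ size w.
Proof.
elim: w => [|i w IH]; first by rewrite /wratio big_nil.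
rewrite wratio_cons exprS; apply: ler_pM => //; last by rewrite ltW ?wratio_gt0.
by have /andP[/ltW] := r01 i.
Qed.

(** The [lead w]-th iterate of [S i0] fixes [x0], and its image of [K] contains both [x0] and the
    cylinder of [w]. *)
Lemma lead_width u w : edot u u = 1 ->
  `|edot u x0 - edot u (wmap w x0)| <= r i0 ^+ lead w * D.
Proof.
elim: w u => [|i w IH] u u1 /=; first by rewrite expr0 mul1r; exact: KD.
case: eqP => [->|_]; last first.
  by rewrite expr0 mul1r; apply: KD => //; exact: (@wmap_attractor (i :: w)).
have r0 : 0 < r i0 by have /andP[] := r01 i0.
rewrite -{1}fix0; have := @edot_wmapB u [:: i0] x0 (wmap w x0).
rewrite /= => ->; rewrite /wratio big_seq1 mul1mx normrM gtr0_norm//.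
by rewrite exprS -mulrA ler_pM2l//; apply: IH; rewrite edot_orth.
Qed.

(** Words starting with [i0] reproduce the energy of the shorter length, the others add [1 - r i0].
    The growth is linear in [n], thus logarithmic in the scale [r i0 ^+ n]. *)
Lemma lead_energy n : \sum_i r i = 1 ->
  \sum_(w <- words n) wratio w / r i0 ^+ lead w = 1 + n%:R * (1 - r i0).
Proof.
move=> r1; have /andP[r0 _] := r01 i0; elim: n => [|n IH].
  by rewrite /= big_seq1 /wratio big_nil /= expr0 divr1 mul0r addr0.
rewrite sum_words (bigD1 i0)//=.
rewrite (_ : \sum_(w <- words n) _ = \sum_(w <- words n) wratio w / r i0 ^+ lead w);
    last first.
  apply: eq_bigr => w _; rewrite eqxx wratio_cons exprS.
  by rewrite -mulf_div divff ?gt_eqF// mul1r.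
rewrite (_ : \sum_(i | i != i0) _ = \sum_(i | i != i0) r i); last first.
  apply: eq_bigr => i /negbTE ->; under eq_bigr do rewrite wratio_cons expr0 divr1.
  by rewrite -mulr_sumr sum_wratio r1 expr1n mulr1.
rewrite IH -natr1; move: r1; rewrite (bigD1 i0)//=; lra.
Qed.

End LeadingLetters.

(* Otherwise let [c > 0] be the supremum of the contents of all shadows. The
   directions of a nearly maximal shadow and of its images under many powers of
   a small rotation cover the circle evenly, and in each of them the cylinders
   are seen essentially disjoint: a strip of width [rho] carries a mass [O(rho / c)]
   of cylinders. Averaging over the directions, a cylinder at distance [d] of a
   point [x0] lies in the strip around [x0] with frequency [rho / d], and the sum
   of these frequencies diverges logarithmically ([lead_energy]). *)
Lemma infinite_rotations_shadow u :
  (forall G : seq 'M[R]_2, exists w, wrot w \notin G) -> edot u u = 1 ->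
  shadow_content u = 0.
Proof.
move=> inf u1; apply/eqP; rewrite eq_le content_ge0 andbT leNgt; apply/negP => Lu0.
have [D D0 KD] := attractor_width.
pose E := [set shadow_content x | x in [set x | edot x x = 1]].
have Esup : has_sup E.
  split; first by exists (shadow_content u), u.
  exists (2 * D + 1) => _ [x /= x1 <-].
  by apply: shadow_content_le => //; exact: ltW.
pose c := sup E.
have Lc x : edot x x = 1 -> shadow_content x <= c.
  by move=> x1; apply: (sup_upper_bound Esup); exists x.
have c0 : 0 < c by apply: lt_le_trans Lu0 (Lc _ u1).
have Xstep x i : edot x x = 1 -> edot (x *m (T i)^T) (x *m (T i)^T) = 1.
  by move=> x1; rewrite edot_orth.
(* A smaller sum would bound every shadow by a fixed fraction of the supremum [c]. *)
have r1 : \sum_i r i = 1.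
  apply/eqP; rewrite eq_le r_le1 /= -(ler_pM2r c0) mul1r.
  apply: ge_sup; first exact: Esup.1.
  move=> _ [x /= x1 <-]; apply: le_trans (shadow_content_step x1) _.
  rewrite mulr_suml; apply: ler_sum => j _; apply: ler_wpM2l.
    by have /andP[/ltW] := r01 j.
  exact/Lc/Xstep.
have [i1 _] : exists i : 'I_m, True.
  by have [[x Kx] _ KE] := attrK; move: Kx; rewrite KE => -[i _ _]; exists i.
have [i0 _ max0] := @arg_maxP _ _ _ i1 xpredT r isT.
have {}max0 i : r i <= r i0 by exact: max0.
set r0 := r i0; have /andP[r00 r0lt] := r01 i0; rewrite -/r0 in r00 r0lt.
have [x0 Kx0 fix0] := @wmap_fixed_point [:: i0] isT.
(* 84 is 2 * 6 * 7: the 2 of [thin_strip_count], the 6 of the strip estimate and the bound 7 on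
   [N%:R * |b|]. *)
have [l lP] : exists l : nat, 84 * D / c < l%:R * (1 - r0).
  exists (Num.truncn (84 * D / c / (1 - r0))).+1.
  by rewrite -ltr_pdivrMr ?subr_gt0//; exact: truncnS_gt.
(* [rho] bounds the width of every cylinder of length [l]. *)
pose rho := r0 ^+ l * D.
have rl0 : 0 < r0 ^+ l by exact: exprn_gt0.
have rho0 : 0 < rho by exact: mulr_gt0.
(* An angle below [r0 ^+ l] is fine enough to apply [thin_strip_count] to every cylinder of length
   [l]. *)
have [w [b [/andP[b0 bl] wb]]] := infinite_rotations_small inf rl0.
have rl1 : r0 ^+ l <= 1 by apply: exprn_ile1 => //; exact: ltW.
have [N [N6 N7]] : exists N : nat, 6 <= N%:R * `|b| /\ N%:R * `|b| <= 7.
  have := truncn_itv (divr_ge0 (ler0n _ 6) (ltW b0)).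
  move: (Num.truncn _) => n; rewrite ler_pdivlMr// ltr_pdivrMr// => /andP[n6 n6'].
  by exists n.+1; rewrite ltW//; split=> //; rewrite -natr1; lra.
(* Along [k] copies of [w] the defect from [c] may grow by the inverse of [wratio w ^+ k]; starting
   below this value keeps it at most [rho] for all [k < N]. *)
have e0 : 0 < rho * wratio w ^+ N by rewrite mulr_gt0// exprn_gt0// wratio_gt0.
have [_ [x1 /= x1u <-] x1c] := sup_adherent e0 Esup.
rewrite -/c in x1c; have [a x1a] := unit_dir x1u.
have dirE k : x1 *m (wrot (wpow k w))^T = dir (a + k%:R * - b).
  rewrite wrot_pow wb x1a; elim: k => [|k IH].
    by rewrite expr0 trmx1 mulmx1 mul0r addr0.
  rewrite exprS -mulmxE trmx_mul mulmxA IH rotN dir_rot -natr1; congr dir; ring.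
have near_max k : (k < N)%N -> c - shadow_content (dir (a + k%:R * - b)) <= rho.
  move=> kN; have := @shadow_content_defect [set x | edot x x = 1] c x1 (wpow k w).
  move=> /(_ (fun x i => Xstep x i) (fun x h => conj h (Lc x h)) x1u).
  rewrite dirE wratio_pow => h.
  have wk : 0 < wratio w ^+ k by rewrite exprn_gt0// wratio_gt0.
  rewrite -(ler_pM2l wk); apply: le_trans h _; rewrite lerBlDr -lerBlDl.
  have : rho * wratio w ^+ N <= wratio w ^+ k * rho.
    rewrite mulrC ler_pM2r//; apply: ler_wiXn2l; last exact: ltnW.
      by rewrite ltW ?wratio_gt0.
    have [->|/wratio_lt1/ltW//] := eqVneq w [::].
    by rewrite /wratio big_nil.
  lra.
(* Cylinders based in the strip project into an interval of length [5 * rho], the others contribute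
   at most [c] times their mass. As the content is within [rho] of [c], the former have mass at most
   [6 * rho / c]. *)
have strip k : (k < N)%N ->
    \sum_(g <- words l | `|edot (dir (a + k%:R * - b)) (x0 - wmap g x0)| <= rho)
      wratio g <= 6 * rho / c.
  move=> kN; set y := dir _.
  have y1 : edot y y = 1 by exact: dir_unit.
  pose V g := `|edot y (x0 - wmap g x0)| <= rho.
  pose B : set R := [set t | edot y x0 - 2 * rho <= t < edot y x0 + 3 * rho].
  have cB : coverable B.
    by apply: (@coverable_itv _ B (edot y x0 - 2 * rho) (edot y x0 + 3 * rho)) => t.
  have Ble : content B <= 5 * rho.
    apply: (@le_trans _ _ (edot y x0 + 3 * rho - (edot y x0 - 2 * rho))); last by lra.
    by apply: content_itv_le => //; lra.
  have := @shadow_content_words y l V B y1 cB.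
  have h : forall g x, size g = l -> V g -> K x -> B (edot y (wmap g x)).
    move=> g x gl; rewrite /V edotBr ler_norml => Vg Kx.
    have : `|edot y (wmap g x) - edot y (wmap g x0)| <= rho.
      rewrite edot_wmapB normrM gtr0_norm ?wratio_gt0//.
      apply: ler_pM => //; first by rewrite ltW ?wratio_gt0.
        by rewrite -gl; exact: wratio_max.
      by apply: KD => //; exact: unit_wrot.
    by rewrite ler_norml /B /=; lra.
  move=> /(_ (fun g x gl Vg Kx => or_introl (h g x gl Vg Kx))) {}h.
  have : shadow_content y <= 5 * rho + (1 - \sum_(g <- words l | V g) wratio g) * c.
    apply: le_trans h _; apply: lerD => //.
    have <- : \sum_(g <- words l | ~~ V g) wratio g = 1 - \sum_(g <- words l | V g) wratio g.
      have := sum_wratio l; rewrite r1 expr1n (bigID V)/=; lra.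
    rewrite mulr_suml; apply: ler_sum => g _; apply: ler_wpM2l.
      by rewrite ltW ?wratio_gt0.
    exact/Lc/unit_wrot.
  have := near_max k kN; rewrite -/y ler_pdivlMr//; lra.
have count g : g \in words l -> r0 ^+ l / r0 ^+ lead i0 g / (2 * `|b|) <=
    \sum_(k < N) ((`|edot (dir (a + k%:R * - b)) (x0 - wmap g x0)| <= rho)%R : nat)%:R.
  rewrite mem_words => /eqP vl; have vlead := lead_size i0 g; rewrite vl in vlead.
  have rv0 : 0 < r0 ^+ lead i0 g by exact: exprn_gt0.
  have Z0 : 0 < r0 ^+ lead i0 g * D by exact: mulr_gt0.
  have rhoZ : rho / (r0 ^+ lead i0 g * D) = r0 ^+ l / r0 ^+ lead i0 g.
    by rewrite /rho -mulf_div divff ?mulr1// gt_eqF.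
  rewrite -rhoZ -normrN; apply: thin_strip_count; rewrite ?normrN//.
  - rewrite rhoZ ler_pdivlMr//; apply: (@le_trans _ _ (r0 ^+ l * 1)); last by rewrite mulr1.
    apply: ler_pM => //; [exact: ltW|exact: ltW|].
    by apply: exprn_ile1 => //; exact: ltW.
  - by rewrite rhoZ ler_pdivrMr// mul1r; apply: ler_wiXn2l => //; exact: ltW.
  - move=> t; apply: le_trans (ler_norm _) _; rewrite edotBr.
    by apply: lead_width => //; exact: dir_unit.
(* Double counting of pairs of a cylinder and a direction: [count] from below for each cylinder,
   [strip] from above for each direction. *)
have total : \sum_(g <- words l) wratio g * (r0 ^+ l / r0 ^+ lead i0 g / (2 * `|b|))
    <= N%:R * (6 * rho / c).
  apply: (@le_trans _ _ (\sum_(g <- words l) \sum_(k < N) wratio g *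
    ((`|edot (dir (a + k%:R * - b)) (x0 - wmap g x0)| <= rho)%R : nat)%:R)).
    rewrite big_seq [leRHS]big_seq; apply: ler_sum => g vl; rewrite -mulr_sumr.
    by apply: ler_wpM2l; [rewrite ltW ?wratio_gt0|exact: count].
  rewrite exchange_big /= mulr_natl -[in leRHS](card_ord N) -sumr_const.
  apply: ler_sum => k _; apply: le_trans (strip k (ltn_ord k)).
  rewrite [leRHS]big_mkcond; apply: ler_sum => g _.
  by case: ifP => _; rewrite ?mulr1 ?mulr0.
have : \sum_(g <- words l) wratio g * (r0 ^+ l / r0 ^+ lead i0 g / (2 * `|b|)) =
    (1 + l%:R * (1 - r0)) * (r0 ^+ l / (2 * `|b|)).
  rewrite -lead_energy// mulr_suml; apply: eq_bigr => g _; ring.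
move=> eqE; rewrite eqE in total.
have : (1 + l%:R * (1 - r0)) * (r0 ^+ l / (2 * `|b|)) <= 42 / `|b| * (r0 ^+ l * D / c).
  apply: le_trans total _; rewrite -/rho.
  have -> : N%:R * (6 * rho / c) = N%:R * 6 * (rho / c) by ring.
  apply: ler_wpM2r; first by apply: divr_ge0; exact: ltW.
  rewrite ler_pdivlMr//; lra.
have -> : 42 / `|b| * (r0 ^+ l * D / c) = (84 * D / c) * (r0 ^+ l / (2 * `|b|)).
  by field; do ?[apply/andP; split]; rewrite ?gt_eqF//; move: b0; rewrite normr_gt0.
rewrite ler_pM2r; last by apply: divr_gt0 => //; exact: mulr_gt0.
lra.
Qed.

(** The ratio is at most [q ^+ n], with [q] the largest of the [r i]; a form of Bernoulli's
    inequality makes this small. *)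
Lemma wratio_small (D e : R) : 0 < D -> 0 < e ->
  exists n, forall w, (n <= size w)%N -> wratio w * D < e.
Proof.
move=> D0 e0; have [[x Kx] _ KE] := attrK.
have [i1 _] : exists i : 'I_m, True.
  by move: Kx; rewrite KE => -[i _ _]; exists i.
have [i0 _ max0] := @arg_maxP _ _ _ i1 xpredT r isT.
have /andP[] := r01 i0; set q := r i0 => q0 q1.
have bernoulli n : q ^+ n * (1 + n%:R * (1 - q)) <= 1.
  elim: n => [|n IH]; first by rewrite expr0 mul0r addr0 mul1r.
  apply: le_trans IH; rewrite exprSr -mulrA ler_pM2l ?exprn_gt0// -natr1.
  have : 0 <= (1 - q) * (1 - q) * (n%:R + 1) 
    by rewrite !mulr_ge0 ?subr_ge0 ?ltW ?addr_ge0 ?ler0n.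
  by lra.
have [n nP] : exists n : nat, D / e < n%:R * (1 - q).
  exists (Num.truncn (D / e / (1 - q))).+1.
  by rewrite -ltr_pdivrMr ?subr_gt0//; exact: truncnS_gt.
exists n => w nw; have qw : wratio w <= q ^+ n.
  apply: le_trans (wratio_max (fun i => max0 i isT) w) _.
  by apply: ler_wiXn2l => //; exact: ltW.
rewrite ltr_pdivrMr// in nP; have b := bernoulli n.
have qn : 0 < q ^+ n by exact: exprn_gt0.
apply: (@le_lt_trans _ _ (q ^+ n * D)); first by rewrite ler_pM2r.
by nra.
Qed.

Lemma wmap_inj w x y : wmap w x = wmap w y -> x = y.
Proof.
move=> wxy; have := wmapB w x y; rewrite wxy subrr => /esym/eqP.
rewrite scaler_eq0 gt_eqF ?wratio_gt0//= => /eqP xy.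
by apply/subr0_eq; rewrite -[LHS]mulmx1 -(wrot_orth w) mulmxA xy mul0mx.
Qed.

(** Common leading letters cancel by injectivity; at the first letter that differs, separation of
    the pieces applies. *)
Lemma wmap_disjoint : strong_separation S K -> forall w g x y, K x -> K y ->
  (size w <= size g)%N -> take (size w) g != w -> wmap w x <> wmap g y.
Proof.
move=> /trivIsetP sepS; elim=> [|i w IH] [|j g] x y Kx Ky //=.
rewrite ltnS => wg; have [->|ij] := eqVneq i j.
  rewrite eqseq_cons eqxx /= => ne /(@wmap_inj [:: j] (wmap w x) (wmap g y)).
  exact: IH.
move=> _ e; have := sepS i j Logic.I Logic.I ij; apply/eqP/set0P.
exists (S i (wmap w x)); split; first by exists (wmap w x) => //; exact: wmap_attractor.
by rewrite e; exists (wmap g y) => //; exact: wmap_attractor.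
Qed.

(** * Finitely many rotation parts *)

Section FiniteRotations.
Variable G : seq 'M[R]_2.
Hypothesis wrotG : forall w, wrot w \in G.

Definition rot_index w : 'I_(size G).+1 := inord (index (wrot w) G).

Lemma rot_index_inj a b : rot_index a = rot_index b -> wrot a = wrot b.
Proof.
move=> /(congr1 val); rewrite /= !inordK ?ltnS ?index_size// => e.
by rewrite -(nth_index 0 (wrotG a)) e nth_index.
Qed.

Lemma wrot_finite_order w : exists k, (0 < k)%N /\ wrot w ^+ k = 1.
Proof.
have [|i [j [_ _ ij cij]]] :=
  @pigeonhole _ _ (fun k => rot_index (wpow k w)) (iota 0 (size G).+2) (iota_uniq _ _).
  by rewrite size_iota card_ord.
have {}cij : wrot w ^+ i = wrot w ^+ j by rewrite -!wrot_pow; exact: rot_index_inj.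
have main a b : (a < b)%N -> wrot w ^+ a = wrot w ^+ b ->
    exists k, (0 < k)%N /\ wrot w ^+ k = 1.
  move=> ab e; exists (b - a)%N; split; first by rewrite subn_gt0.
  by rewrite -(wrot_expB _ (ltnW ab)) -e -wrot_pow wrot_orth.
by case: (ltngtP i j) ij => // h _; [exact: main h cij|exact: main h (esym cij)].
Qed.

(** The finite orbit has a direction of maximal content, and [shadow_content_defect] propagates
    maximality along words. Finite order leads from that direction back to [u], and from [u]
    maximality reaches the whole orbit. *)
Lemma shadow_content_orbit u w : edot u u = 1 ->
  shadow_content (u *m (wrot w)^T) = shadow_content u.
Proof.
move=> u1; pose L w := shadow_content (u *m (wrot w)^T).
have [|M [_ [w0 w0M] Mmax]] := @arg_max_seq _ _ G (fun M => exists w, wrot w = M)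
  (fun M => shadow_content (u *m M^T)).
  by exists (wrot [::]) => //; exists [::].
have Lmax g : L g <= L w0 by rewrite /L w0M; apply: Mmax => //; exists g.
pose X := [set x | exists g, x = u *m (wrot g)^T].
have XT x i : X x -> X (x *m (T i)^T).
  move=> [g ->]; exists (g ++ [:: i]).
  by rewrite wrot_cat /= mul1mx trmx_mul mulmxA.
have XL x : X x -> edot x x = 1 /\ shadow_content x <= L w0.
  by move=> [g ->]; split; [exact: unit_wrot|exact: Lmax].
have Xu : X u by exists [::]; rewrite /= trmx1 mulmx1.
have uL : L w0 <= shadow_content u.
  have [k [k0 wk]] := wrot_finite_order w0.
  have := @shadow_content_defect X (L w0) (u *m (wrot w0)^T) (wpow k.-1 w0) XT XL.
  rewrite (finite_order_inverse k0 wk) trmxK -mulmxA (mulmx1C (wrot_orth w0)) mulmx1.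
  have -> : L w0 - shadow_content (u *m (wrot w0)^T) = 0 by rewrite /L subrr.
  have := wratio_gt0 (wpow k.-1 w0).
  move=> q0 /(_ (ex_intro _ w0 erefl)); rewrite pmulr_rle0// subr_le0.
  by [].
have := @shadow_content_defect X (L w0) u w XT XL Xu.
have e : L w0 - shadow_content u <= 0 by rewrite subr_le0.
move=> /le_trans/(_ e); rewrite pmulr_rle0 ?wratio_gt0// subr_le0 => Lw.
have := Lmax w; rewrite /L in Lw uL *.
have := (XL _ Xu).2; rewrite /L; lra.
Qed.

(* A maximizing point has an address that passes twice through the same
   rotation; the fixed point of the corresponding loop is also maximizing. *)
Lemma finite_support : exists V : seq 'rV[R]_2,
  (forall p, p \in V -> K p) /\
  forall u, edot u u = 1 -> exists2 p, p \in V & forall y, K y -> edot u y <= edot u p.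
Proof.
have /choice[fp fpP] : forall w : seq 'I_m, exists p : 'rV[R]_2,
    w != [::] -> K p /\ wmap w p = p.
  move=> w; have [->|/wmap_fixed_point[p Kp wp]] := eqVneq w [::]; first by exists 0.
  by exists p.
(* A word of length [n.-1] has [n] prefixes, the empty one included: one more than the values of
   [rot_index]. *)
pose n := (size G).+2.
have [W memW] : exists W : seq (seq 'I_m), forall w, (size w < n)%N -> w \in W.
  exists (flatten [seq words k | k <- iota 0 n]) => w wn.
  apply/flattenP; exists (words (size w)); last by rewrite mem_words.
  by apply: map_f; rewrite mem_iota.
exists [seq wmap a (fp b) | a <- W, b <- [seq b <- W | b != [::]]]; split.
  move=> _ /allpairsP[[a b] /= [_ + ->]]; rewrite mem_filter => /andP[bn _].
  by apply: wmap_attractor; exact: (fpP _ bn).1.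
move=> u u1; have [K0 Kc _] := attrK.
have [x /set_mem Kx xmax] :=
  EVT_max_rV K0 Kc (continuous_subspaceT (edot_continuous (u := u))).
have [w [y [wn Ky xE]]] := attractor_words n.-1 Kx.
have main i j : (i < j)%N -> (j <= n.-1)%N -> wrot (take i w) = wrot (take j w) ->
    exists2 p, p \in [seq wmap a (fp b) | a <- W, b <- [seq b <- W | b != [::]]] &
      forall y, K y -> edot u y <= edot u p.
  move=> ij jn; pose a := take i w; pose b := drop i (take j w).
  have ab : take j w = a ++ b.
    by rewrite /a /b -{1}(cat_take_drop i (take j w)) take_takel// ltnW.
  rewrite -/a ab wrot_cat => rotE.
  (* The loop [b] has trivial rotation part, so [wmap b] is a homothety centred at [p]. *)
  have b1 : wrot b = 1%:M.
    rewrite -[LHS]mulmx1 -(wrot_orth a) mulmxA -rotE wrot_orth //.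
  have sa : size a = i.
    by rewrite size_takel// wn (leq_trans (ltnW ij)).
  have sj : size (take j w) = j by rewrite size_takel// wn.
  have bn : b != [::] by rewrite -size_eq0 size_drop sj subn_eq0 -ltnNge.
  have [Kp bp] := fpP _ bn; set p := fp b in Kp bp.
  have xw : x = wmap a (wmap b (wmap (drop j w) y)).
    by rewrite xE -[in LHS](cat_take_drop j w) ab !wmap_cat.
  set xj := wmap (drop j w) y in xw; have Kxj : K xj by exact: wmap_attractor.
  pose u' := u *m (wrot a)^T.
  have u'max z : K z -> edot u' z <= edot u' (wmap b xj).
    move=> Kz; have := edot_wmapB u a (wmap b xj) z; rewrite -xw.
    have := xmax _ (mem_set (wmap_attractor a Kz)); have := wratio_gt0 a.
    by rewrite -/u' => q0 h e; rewrite -subr_ge0 -(pmulr_rge0 _ q0) -e subr_ge0.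
  (* The homothety carries [xj] to a maximizer in direction [u']. If [p] were lower, [xj] would be
     higher than that maximizer. *)
  have pmax : edot u' (wmap b xj) <= edot u' p.
    have := edot_wmapB u' b xj p; rewrite b1 trmx1 mulmx1 bp.
    have := u'max _ Kxj; have := wratio_gt0 b; have := wratio_lt1 bn; nra.
  exists (wmap a p).
    apply/allpairsP; exists (a, b); split=> //=.
      by apply: memW; rewrite sa; lia.
    rewrite mem_filter bn /=; apply: memW; rewrite size_drop sj; lia.
  move=> z Kz; apply: le_trans (xmax _ (mem_set Kz)) _; rewrite xw.
  have := edot_wmapB u a (wmap b xj) p; rewrite -/u'; have := wratio_gt0 a; nra.
have [|i [j [iI jI ij cij]]] :=
  @pigeonhole _ _ (fun k => rot_index (take k w)) (iota 0 n) (iota_uniq _ _).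
  by rewrite size_iota card_ord.
rewrite !mem_iota /= in iI jI.
case: (ltngtP i j) ij => // h _; [apply: (main i j h)|apply: (main j i h)].
- by lia.
- exact: rot_index_inj.
- by lia.
- by apply: rot_index_inj.
Qed.

(** The projection of the cylinder of [w] is a full interval. A long cylinder around [wmap g y]
    would project into it and could be dropped from the subadditive bound. All directions of the
    orbit having the same positive content, the remaining ratios would sum to at least 1, although
    the total is at most 1. *)
Lemma gap_no_shadow u w g (xa xb : 'rV[R]_2) y :
  edot u u = 1 -> is_interval (shadow u) ->
  K xa -> K xb -> (forall x, K x -> edot u xa <= edot u x <= edot u xb) ->
  edot u xa < edot u xb -> wrot w = 1%:M ->
  (size w <= size g)%N -> take (size w) g != w -> K y ->
  edot u (wmap w xa) < edot u (wmap g y) < edot u (wmap w xb) -> False.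
Proof.
move=> u1 iP Kxa Kxb bnd ab w1 wg gw Ky /andP[sy yt].
have [D D0 KD] := attractor_width.
pose e := Num.min (edot u (wmap g y) - edot u (wmap w xa))
  (edot u (wmap w xb) - edot u (wmap g y)).
have e0 : 0 < e by rewrite lt_min !subr_gt0 sy yt.
have [N NP] := wratio_small D0 e0.
have [h [y' [hN Ky' yE]]] := attractor_words N Ky.
pose g' := g ++ h; pose M := size g'.
have gy : wmap g y = wmap g' y' by rewrite yE wmap_cat.
have wratio_g' : wratio g' * D < e.
  by apply: NP; rewrite size_cat hN leq_addl.
have cover x : K x -> exists q z, [/\ size q = M, ~~ pred1 g' q, K z &
    edot u (wmap g' x) = edot u (wmap q z)].
  move=> Kx; have : `|edot u (wmap g' x) - edot u (wmap g y)| < e.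
    rewrite gy edot_wmapB normrM gtr0_norm ?wratio_gt0//.
    apply: le_lt_trans wratio_g'; rewrite ler_pM2l ?wratio_gt0//.
    by apply: KD => //; exact: unit_wrot.
  rewrite lt_min => /andP[]; rewrite !ltr_norml => /andP[l1 l2] /andP[l3 l4].
  have wE z : edot u (wmap w z) = edot u (wmap w xa) + wratio w * (edot u z - edot u xa).
    by have := edot_wmapB u w z xa; rewrite w1 trmx1 mulmx1; lra.
  have q0 := wratio_gt0 w.
  (* [f] undoes the affine map that [wmap w] induces on projections. *)
  pose f := (edot u (wmap g' x) - edot u (wmap w xa)) / wratio w + edot u xa.
  have [z Kz zf] : shadow u f.
    apply: (iP (edot u xa) (edot u xb)); [by exists xa|by exists xb|].
    have := wE xb => wb; rewrite /f lerDr -lerBrDr ler_pdivrMr//.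
    by apply/andP; split; [apply: divr_ge0; lra|lra].
  have [q [z' [qM Kz' zE]]] := attractor_words (M - size w) Kz.
  have wM : (size w <= M)%N by rewrite /M size_cat (leq_trans wg)// leq_addr.
  exists (w ++ q), z'; split=> //; first by rewrite size_cat qM subnKC.
    apply: contra gw => /eqP wq; have : take (size w) (w ++ q) = take (size w) g'.
      by rewrite wq.
    rewrite take_size_cat// take_cat.
      case: ltngtP wg => // [_ _ <-//|-> _].
    by rewrite subnn take0 cats0 take_size => <-.
  rewrite wmap_cat -zE wE zf /f addrK mulrC divfK ?gt_eqF//; lra.
have [c0 E0] := @content_set0 R.
have := @shadow_content_words u M (pred1 g') set0 u1 c0
  (fun q x _ Vq Kx => or_intror (eq_ind_r (fun q => _) (cover x Kx) (eqP Vq))).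
rewrite E0 add0r; under eq_bigr do rewrite shadow_content_orbit//.
rewrite -mulr_suml; have := sum_wratio M; rewrite (bigID (pred1 g'))/=.
set A := \sum_(i <- _ | i == g') _; set B := \sum_(i <- _ | i != g') _.
have Apos : 0 < A.
  have g'M : g' \in words M by rewrite mem_words.
  rewrite /A big_mkcond (perm_big _ (perm_to_rem g'M)) big_cons eqxx.
  apply: ltr_wpDr; last exact: wratio_gt0.
  by apply: sumr_ge0 => q _; case: ifP => // _; rewrite ltW ?wratio_gt0.
have sum1 : (\sum_i r i) ^+ M <= 1.
  apply: exprn_ile1 => //; apply: sumr_ge0 => i _.
  by have /andP[/ltW] := r01 i.
have Lpos : 0 < shadow_content u.
  apply: (@lt_le_trans _ _ (edot u xb - edot u xa)); first by rewrite subr_gt0.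
  by apply: content_interval => //; [exact: coverable_shadow|exists xa|exists xb].
by nra.
Qed.

(** With [t] and [s] the right and left ends of the cylinder of [w], values just above [t] must come
    from other cylinders of length [n]. These avoid the gap between [s] and [t] and are too short to
    cross it, so one of them starts exactly at [t]. *)
Lemma touching_cylinders_right (D : R) (V : seq 'rV[R]_2) u w n (xa xb : 'rV[R]_2) :
  strong_separation S K ->
  (forall u x y, edot u u = 1 -> K x -> K y -> `|edot u x - edot u y| <= D) ->
  (forall p, p \in V -> K p) ->
  (forall u, edot u u = 1 -> exists2 p, p \in V & forall y, K y -> edot u y <= edot u p) ->
  edot u u = 1 -> is_interval (shadow u) ->
  K xa -> K xb -> (forall x, K x -> edot u xa <= edot u x <= edot u xb) ->
  wrot w = 1%:M -> (size w <= n)%N ->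
  (forall g, size g = n -> wratio g * D < wratio w * (edot u xb - edot u xa)) ->
  edot u (wmap w xb) < edot u xb ->
  exists p q g, [/\ p \in V, q \in V, g \in words n, wmap w p - wmap g q != 0 &
    edot u (wmap w p - wmap g q) = 0].
Proof.
move=> sepS KD VK Vmax u1 iP Kxa Kxb bnd w1 wn small tb.
have tE z : edot u (wmap w xb) - edot u (wmap w z) = wratio w * (edot u xb - edot u z).
  by have := edot_wmapB u w xb z; rewrite w1 trmx1 mulmx1.
set t := edot u (wmap w xb) in tb tE.
have q0 := wratio_gt0 w.
have at_le : edot u xa <= t by have /andP[] := bnd _ (wmap_attractor w Kxb).
have ab : edot u xa < edot u xb by lra.
pose s := edot u (wmap w xa).
have st : t - s = wratio w * (edot u xb - edot u xa) by exact: tE.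
have gap g y : size g = n -> take (size w) g != w -> K y ->
    s < edot u (wmap g y) < t -> False.
  by move=> gn gw Ky; apply: (gap_no_shadow u1 iP Kxa Kxb bnd ab w1) => //; rewrite gn.
have /choice[q qP] : forall g, exists q, q \in V /\
    forall y, K y -> edot u (wmap g q) <= edot u (wmap g y).
  move=> g; have [|q Vq qmax] := Vmax (- (u *m (wrot g)^T)).
    by rewrite edotNl edotC edotNl opprK unit_wrot.
  exists q; split => // y Ky; have := edot_wmapB u g q y.
  have := qmax y Ky; rewrite !edotNl; have := wratio_gt0 g; nra.
pose cand g := (take (size w) g != w) && (t <= edot u (wmap g (q g))).
have [[g [gn /andP[gw tg] gt]]|no] := pselect (exists g,
    [/\ size g = n, cand g & edot u (wmap g (q g)) <= t]).
  have [p Vp pmax] := Vmax u u1.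
  exists p, (q g), g; split; rewrite ?mem_words ?gn//; first exact: (qP g).1.
    rewrite subr_eq0; apply/eqP; apply: wmap_disjoint => //; rewrite ?gn//; apply: VK => //.
    exact: (qP g).1.
  have pb : edot u p = edot u xb.
    by apply/eqP; rewrite eq_le pmax// andbT; have /andP[] := bnd _ (VK _ Vp).
  have := tE p; rewrite edotBr pb subrr mulr0; lra.
exfalso.
(* As no candidate starts at [t], some value [f] beyond [t] precedes the left ends of all
   candidates. *)
have [f /andP[tf fb] fcand] : exists2 f, t < f < edot u xb &
    forall g, size g = n -> cand g -> f < edot u (wmap g (q g)).
  have [[g [gn cg]]|nocand] := pselect (exists g, size g = n /\ cand g); last first.
    exists ((t + edot u xb) / 2); first by apply/andP; split; lra.
    by move=> g gn cg; exfalso; apply: nocand; exists g.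
  have [|g0 [g0n cg0 g0min]] := 
      @arg_max_seq _ _ (words n) cand (fun g => - edot u (wmap g (q g))).
    by exists g; rewrite ?mem_words ?gn.
  have tg0 : t < edot u (wmap g0 (q g0)).
    rewrite ltNge; apply/negP => h; apply: no; exists g0; split=> //.
    by apply/eqP; rewrite -mem_words.
  exists ((t + Num.min (edot u xb) (edot u (wmap g0 (q g0)))) / 2).
    have h1 : t < Num.min (edot u xb) (edot u (wmap g0 (q g0))) by rewrite lt_min tb.
    have h2 : Num.min (edot u xb) (edot u (wmap g0 (q g0))) <= edot u xb.
      by rewrite ge_min lexx.
    by apply/andP; split; lra.
  move=> h hn ch; have hW : h \in words n by rewrite mem_words hn.
  have h2 : Num.min (edot u xb) (edot u (wmap g0 (q g0))) <= edot u (wmap g0 (q g0)).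
    by rewrite ge_min lexx orbT.
  have := g0min h hW ch; lra.
have [x Kx xf] : shadow u f.
  by apply: (iP (edot u xa) (edot u xb)); [exists xa|exists xb|lra].
(* This cylinder reaches [f > t], so it does not extend [w]. It cannot start at [t] or later, nor
   inside the gap; starting at [s] or before, it would be wider than [t - s]. *)
have [g [y [gn Ky xE]]] := attractor_words n Kx.
have [gw|gw] := eqVneq (take (size w) g) w.
  have : edot u x <= t.
    rewrite xE -(cat_take_drop (size w) g) gw wmap_cat.
    have Kz := wmap_attractor (drop (size w) g) Ky.
    have := tE (wmap (drop (size w) g) y); have /andP[_] := bnd _ Kz; nra.
  lra.
have mf : edot u (wmap g (q g)) <= f by rewrite -xf xE; exact: (qP g).2.
have mt : edot u (wmap g (q g)) < t.
  rewrite ltNge; apply/negP => h.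
  by have := fcand g gn; rewrite /cand gw h => /(_ isT); lra.
have Kq : K (q g) by apply: VK; exact: (qP g).1.
have ms : edot u (wmap g (q g)) <= s.
  rewrite leNgt; apply/negP => h; apply: (gap g (q g)) => //.
  by rewrite h mt.
have : `|edot u (wmap g y) - edot u (wmap g (q g))| <= wratio g * D.
  rewrite edot_wmapB normrM gtr0_norm ?wratio_gt0// ler_pM2l ?wratio_gt0//.
  by apply: KD => //; exact: unit_wrot.
rewrite -xE xf ler_norml => /andP[_]; have := small g gn; lra.
Qed.

(** A nonempty [w] contracts, so the two ends of its cylinder cannot both be ends of the shadow. If
    only the left one is interior, [- u] replaces [u]. *)
Lemma touching_cylinders (D : R) (V : seq 'rV[R]_2) u w n (xa xb : 'rV[R]_2) :
  strong_separation S K ->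
  (forall u x y, edot u u = 1 -> K x -> K y -> `|edot u x - edot u y| <= D) ->
  (forall p, p \in V -> K p) ->
  (forall u, edot u u = 1 -> exists2 p, p \in V & forall y, K y -> edot u y <= edot u p) ->
  edot u u = 1 -> is_interval (shadow u) ->
  K xa -> K xb -> (forall x, K x -> edot u xa <= edot u x <= edot u xb) ->
  edot u xa < edot u xb ->
  w != [::] -> wrot w = 1%:M -> (size w <= n)%N ->
  (forall g, size g = n -> wratio g * D < wratio w * (edot u xb - edot u xa)) ->
  exists p q g, [/\ p \in V, q \in V, g \in words n, wmap w p - wmap g q != 0 &
    edot u (wmap w p - wmap g q) = 0].
Proof.
move=> sepS KD VK Vmax u1 iP Kxa Kxb bnd ab w0 w1 wn small.
have [tb|bt] := ltP (edot u (wmap w xb)) (edot u xb).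
  exact: (@touching_cylinders_right D V u w n xa xb).
have Nu1 : edot (- u) (- u) = 1 by rewrite edotNl edotC edotNl opprK.
have [||||p [q [g [Vp Vq gn z0 uz]]]] :=
    @touching_cylinders_right D V (- u) w n xb xa sepS KD VK Vmax Nu1 _ Kxb Kxa _ w1 wn.
- move=> _ _ [x Kx <-] [y Ky <-] z; rewrite !edotNl => xzy.
  have [|zP Kz zE] := iP (edot u y) (edot u x) (ex_intro2 _ _ y Ky erefl)
    (ex_intro2 _ _ x Kx erefl) (- z); first by lra.
  by exists zP; rewrite // edotNl zE opprK.
- by move=> x /bnd; rewrite !edotNl !lerN2 andbC.
- by move=> g /small; rewrite !edotNl opprK [- _ + _]addrC.
- have := edot_wmapB u w xb xa; rewrite w1 trmx1 mulmx1 !edotNl.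
  have := wratio_gt0 w; have := wratio_lt1 w0; nra.
by exists p, q, g; split=> //; move: uz; rewrite edotNl => /eqP; rewrite oppr_eq0 => /eqP.
Qed.

(** The length [n] must not depend on [u], which calls for a lower bound on the width of [K] over
    all directions; three points of [K] that are not collinear give one. *)
Lemma interval_directions_finite : strong_separation S K ->
  exists Z : seq 'rV[R]_2, forall u, edot u u = 1 -> is_interval (shadow u) ->
    (exists x y, [/\ K x, K y & edot u x <> edot u y]) ->
    exists z, [/\ z \in Z, z != 0 & edot u z = 0].
Proof.
move=> sepS; have [K0 Kc KE] := attrK.
have [D D0 KD] := attractor_width; have [V [VK Vmax]] := finite_support.
have [i0 _] : exists i : 'I_m, True.
  by have [x Kx] := K0; move: Kx; rewrite KE => -[i _ _]; exists i.
have [k [k0 wk]] := wrot_finite_order [:: i0].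
pose w := wpow k [:: i0].
have w1 : wrot w = 1%:M by rewrite wrot_pow.
have wn0 : w != [::] by rewrite /w /wpow; case: k k0 {wk w w1}.
have q0 := wratio_gt0 w.
have touch e : 0 < e -> exists n, (size w <= n)%N /\
    forall g, size g = n -> wratio g * D < wratio w * e.
  move=> e0; have [n nP] := wratio_small D0 (mulr_gt0 q0 e0).
  exists (maxn n (size w)); rewrite leq_maxr; split=> // g gn.
  by apply: nP; rewrite gn leq_maxl.
have extrema u : (exists x y, [/\ K x, K y & edot u x <> edot u y]) ->
    exists xa xb, [/\ K xa, K xb, forall x, K x -> edot u xa <= edot u x <= edot u xb &
      edot u xa < edot u xb].
  move=> [x [y [Kx Ky xy]]].
  have cu := continuous_subspaceT (edot_continuous (u := u)).
  have [xa /set_mem Kxa amin] := EVT_min_rV K0 Kc (cu K).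
  have [xb /set_mem Kxb bmax] := EVT_max_rV K0 Kc (cu K).
  have bnd z : K z -> edot u xa <= edot u z <= edot u xb.
    by move=> Kz; rewrite amin ?bmax//; exact/mem_set.
  exists xa, xb; split=> //.
  have /andP[x1 x2] := bnd x Kx; have /andP[y1 y2] := bnd y Ky.
  by rewrite ltNge; apply/negP => h; apply: xy; lra.
have [[x [y [z [Kx Ky Kz dxyz]]]]|collinear] :=
    pselect (exists x y z, [/\ K x, K y, K z & det (y - x) (z - x) <> 0]).
  pose d := `|det (y - x) (z - x)|; have d0 : 0 < d by rewrite normr_gt0; apply/eqP.
  (* The lower bound on the width that [det_le_width] yields. *)
  pose e := d / (4 * D); have e0 : 0 < e by rewrite divr_gt0// mulr_gt0.
  have [n [wn nP]] := touch e e0.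
  exists [seq wmap w pq.1 - wmap g pq.2 | pq <- [seq (p, q) | p <- V, q <- V], g <- words n].
  move=> u u1 iP /extrema[xa [xb [Kxa Kxb bnd ab]]].
  have width : e <= edot u xb - edot u xa.
    have osc a b : K a -> K b -> `|edot u (a - b)| <= edot u xb - edot u xa.
      move=> /bnd/andP[a1 a2] /bnd/andP[b1 b2].
      by rewrite edotBr ler_norml; apply/andP; split; lra.
    have coord a b : K a -> K b -> `|(a - b) 0 0| <= D /\ `|(a - b) 0 1| <= D.
      move=> Ka Kb; split.
        have := KD (dir 0) a b (dir_unit 0) Ka Kb.
        by rewrite -edotBr edotE ![dir _ _ _]mxE /= cos0 sin0 mul1r mul0r addr0.
      have := KD (dir (pi / 2)) a b (dir_unit (pi / 2)) Ka Kb.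
      by rewrite -edotBr edotE ![dir _ _ _]mxE /= cos_pihalf sin_pihalf mul1r mul0r add0r.
    have op := osc _ _ Ky Kx; have os := osc _ _ Kz Kx.
    have [p0 p1] := coord _ _ Ky Kx; have [s0 s1] := coord _ _ Kz Kx.
    rewrite /e ler_pdivrMr ?mulr_gt0// mulrC.
    exact: (det_le_width u1 p0 p1 s0 s1 op os).
  have [|p [q [g [Vp Vq gn z0 uz]]]] := @touching_cylinders D V u w n xa xb
    sepS KD VK Vmax u1 iP Kxa Kxb bnd ab wn0 w1 wn.
    by move=> g gn; apply: lt_le_trans (nP g gn) _; rewrite ler_pM2l.
  exists (wmap w p - wmap g q); split=> //; apply/allpairsP; exists ((p, q), g).
  by split=> //; apply/allpairsP; exists (p, q).
(* If [K] lies on a line, a nonzero difference of its points is parallel to [xb - xa], hence not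
   orthogonal to [u]: no such direction exists. *)
exists [::] => u u1 iP /extrema[xa [xb [Kxa Kxb bnd ab]]]; exfalso.
have [|n [wn nP]] := touch (edot u xb - edot u xa); first by rewrite subr_gt0.
have [p [q [g [/VK Kp /VK Kq gn z0 uz]]]] := @touching_cylinders D V u w n xa xb
  sepS KD VK Vmax u1 iP Kxa Kxb bnd ab wn0 w1 wn nP.
set p' := wmap w p in z0 uz; set q' := wmap g q in z0 uz.
have Kp' : K p' by exact: wmap_attractor.
have Kq' : K q' by exact: wmap_attractor.
have flat a : K a -> det (xb - xa) (a - xa) = 0.
  by move=> Ka; apply: contrapT => h; apply: collinear; exists xa, xb, a.
have dz : det (xb - xa) (p' - q') = 0.
  have := flat _ Kp'; have := flat _ Kq'; rewrite /det !mxE; lra.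
have eb : 0 < edot u (xb - xa) by rewrite edotBr subr_gt0.
move/negP: z0; apply; apply/eqP; move: dz uz eb; rewrite /det !edotE.
move: (xb - xa) (p' - q') => e z dz uz eb.
have h0 : (u 0 0 * e 0 0 + u 0 1 * e 0 1) * z 0 0 = 0.
  have -> : (u 0 0 * e 0 0 + u 0 1 * e 0 1) * z 0 0 =
    e 0 0 * (u 0 0 * z 0 0 + u 0 1 * z 0 1) - u 0 1 * (e 0 0 * z 0 1 - e 0 1 * z 0 0) by ring.
  by rewrite uz dz; ring.
have h1 : (u 0 0 * e 0 0 + u 0 1 * e 0 1) * z 0 1 = 0.
  have -> : (u 0 0 * e 0 0 + u 0 1 * e 0 1) * z 0 1 =
    e 0 1 * (u 0 0 * z 0 0 + u 0 1 * z 0 1) + u 0 0 * (e 0 0 * z 0 1 - e 0 1 * z 0 0) by ring.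
  by rewrite uz dz; ring.
move/eqP: h0; rewrite mulf_eq0 gt_eqF//= => /eqP z0.
move/eqP: h1; rewrite mulf_eq0 gt_eqF//= => /eqP z1.
by apply/rowP => j; rewrite mxE; case: (ord2P j) => ->.
Qed.

End FiniteRotations.

End RatioSum.

(** A single point has measure 0, so [K] has two distinct points [x] and [y]; degenerate shadows
    occur only in directions orthogonal to [x - y]. *)
Lemma interval_shadow_finite : strong_separation S K -> one_set K ->
  exists Z : seq 'rV[R]_2, forall u, edot u u = 1 -> is_interval (shadow u) ->
    exists z, [/\ z \in Z, z != 0 & edot u z = 0].
Proof.
move=> sepS oneK; have r_le1 := sum_ratio_le1 sepS oneK.
have [x [y [Kx Ky xy]]] : exists x y, [/\ K x, K y & x - y != 0].
  apply: contrapT => no; have [[x Kx] _ _] := attrK.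
  have Kx1 : K = [set x].
    apply/seteqP; split => [y Ky|_ ->//]; apply/eqP; rewrite -subr_eq0.
    by apply: contrapT => /negP yx; apply: no; exists y, x.
  by case/andP: oneK; rewrite Kx1 hausdorff1_set1 ltxx.
have degenerate u : ~ (exists x y, [/\ K x, K y & edot u x <> edot u y]) ->
    edot u (x - y) = 0.
  move=> no; apply: contrapT => h; apply: no; exists x, y; split => // e.
  by apply: h; rewrite edotBr e subrr.
have [[G wrotG]|inf] := pselect (exists G : seq 'M[R]_2, forall w, wrot w \in G).
  have [Z ZP] := interval_directions_finite r_le1 wrotG sepS.
  exists (x - y :: Z) => u u1 iP.
  have [/(ZP u u1 iP)[z [zZ z0 uz]]|/degenerate uxy] :=
      pselect (exists x y, [/\ K x, K y & edot u x <> edot u y]).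
    by exists z; rewrite inE zZ orbT.
  by exists (x - y); rewrite mem_head.
exists [:: x - y] => u u1 iP; exists (x - y); rewrite mem_head; split=> //.
have {}inf (G : seq 'M[R]_2) : exists w, wrot w \notin G.
  apply: contrapT => no; apply: inf; exists G => w.
  by apply: contrapT => /negP wG; apply: no; exists w.
have L0 := infinite_rotations_shadow r_le1 inf u1.
have le a b : K a -> K b -> edot u b - edot u a <= 0.
  move=> Ka Kb; rewrite -L0; apply: content_interval => //; first exact: coverable_shadow.
    by exists a.
  by exists b.
by rewrite edotBr; have := le x y Kx Ky; have := le y x Ky Kx; lra.
Qed.

End IFS.

(** * From unit directions to lines through the origin *)

Section Lines.
Context {R : realType}.
Implicit Types (u z : 'rV[R]_2) (K : set 'rV[R]_2) (M : {vspace 'rV[R]_2}).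

Lemma line_vline M u : \dim M = 1%N -> u \in M -> u != 0 -> M = <[u]>%VS.
Proof.
move=> M1 uM u0; apply/esym/eqP; rewrite eqEdim dim_vline u0 M1 leqnn andbT.
by rewrite -memvE.
Qed.

Lemma orth_proj_vline u x : edot u u = 1 -> orth_proj <[u]> x = edot u x *: u.
Proof.
move=> u1; apply: xget_unique.
  split; first by apply: memvZ; exact: memv_line.
  by move=> _ /vlineP[k ->]; rewrite edotZr edotC edotBr edotZr u1; ring.
move=> _ [/vlineP[k ->] /(_ u (memv_line u))].
by rewrite edotC edotBr edotZr u1 mulr1 => /subr0_eq ->.
Qed.

Lemma interval_projection_shadow K M : \dim M = 1%N -> interval_projection K M ->
  exists u, [/\ edot u u = 1, M = <[u]>%VS & is_interval (shadow K u)].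
Proof.
move=> M1 [u [uM un iP]].
have u1 : edot u u = 1 by rewrite -(sqr_sqrtr (edot_ge0 u)) -/(enorm u) un expr1n.
have u0 : u != 0.
  by apply/eqP => u0; move/eqP: u1; rewrite u0 edotE !mxE mul0r addr0 eq_sym oner_eq0.
have ME := line_vline M1 uM u0.
exists u; split=> //; rewrite (_ : shadow K u = [set t : R | (orth_proj M @` K) (t *: u)]) //.
rewrite ME; apply/seteqP; split => t /=.
  by move=> [x Kx <-]; exists x => //; rewrite orth_proj_vline.
move=> [x Kx]; rewrite orth_proj_vline// => /eqP.
rewrite -subr_eq0 -scalerBl scaler_eq0 (negbTE u0) orbF subr_eq0 => /eqP <-.
by exists x.
Qed.

Definition perp z : 'rV[R]_2 := \row_j (if j == 0 then - z 0 1 else z 0 0).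

(** In the plane a nonzero [z] has only one orthogonal line, so finitely many [z] leave finitely
    many lines. *)
Lemma vline_perp u z : u != 0 -> z != 0 -> edot u z = 0 -> <[u]>%VS = <[perp z]>%VS.
Proof.
move=> u0 z0 uz; have zz : edot z z != 0 by apply/eqP => /edot_eq0/eqP; exact/negP.
have p0 : perp z != 0.
  apply: contra_neq z0 => p0; apply/rowP => j; rewrite mxE.
  have h k : perp z 0 k = 0 by rewrite p0 mxE.
  have := h 0; have := h 1; rewrite ![perp _ _ _]mxE /= => e0 /eqP.
  by rewrite oppr_eq0 => /eqP e1; case: (ord2P j) => ->.
apply/esym/line_vline => //; first by rewrite dim_vline p0.
apply/vlineP; exists (edot (perp z) u / edot z z); apply: (scalerI zz).
rewrite scalerA mulrC divfK//; apply/rowP => j.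
move: uz; rewrite !edotE !mxE /= => uz.
have e0 : u 0 0 * z 0 0 = - (u 0 1 * z 0 1) by lra.
by case: (ord2P j) => -> /=; [ring: e0|ring: e0].
Qed.

End Lines.

Theorem theorem1p2 (R : realType) (m : nat) (S : 'I_m -> 'rV[R]_2 -> 'rV[R]_2)
    (K : set 'rV[R]_2) :
  ss_ifs S -> attractor S K -> strong_separation S K -> one_set K ->
  finite_set [set M : {vspace 'rV[R]_2} |
               \dim M = 1%N /\ interval_projection K M].
Proof.
move=> /choice[r /choice[T /choice[v rTv]]] attrK sepS oneK.
have r01 i : 0 < r i < 1 by have [] := rTv i.
have TT i : T i *m (T i)^T = 1%:M by have [] := rTv i.
have SE i x : S i x = r i *: (x *m T i) + v i by have [_ _] := rTv i.
have [Z ZP] := interval_shadow_finite SE r01 TT attrK sepS oneK.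
apply: (@sub_finite_set _ _ [set <[perp z]>%VS | z in [set` Z]]).
  move=> M [M1 /(interval_projection_shadow M1)[u [u1 -> iP]]].
  have [z [zZ z0 uz]] := ZP u u1 iP; exists z => //.
  apply/esym/vline_perp => //.
  by apply/eqP => u0; move/eqP: u1; rewrite u0 edotE !mxE mul0r addr0 eq_sym oner_eq0.
exact/finite_image/finite_seq.
Qed.
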